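(* Let $n\ge 1$, $\alpha,\beta\in(0,1)$, and let $\mathbf X=\{X_i,\ i=1,\dots,n\}$ be a stationary Markov chain with state space $\{0,1\}$ and transition matrix $\begin{pmatrix}1-\alpha&\alpha\\1-\beta&\beta\end{pmatrix}$ (rows and columns indexed by $0,1$). Let $S=\sum_{i=1}^nX_i$, with law $\mathcal L S$, and let $p=\frac{\alpha}{1-\beta+\alpha}$, so that $\mathbb E S=np$. With the constants $C_0,C_1,C_2,K_1,K_2$ (explicit functions of $\alpha,\beta$) given in the context, the following hold. 1. If $\operatorname{Var}S\ge \mathbb E S$, then $$d_{\mathrm{TV}}(\mathcal L S,\mathrm{NB}(r,q))\le C_0\left[\frac{2K_1}{\sqrt n}+\frac{4K_2}{n}+\beta^{\lfloor n/4\rfloor}\right],$$ where $$r=\frac{(\mathbb E S)^2}{\operatorname{Var}S-\mathbb E S},\qquad q=\frac{\mathbb E S}{\operatorname{Var}S},$$ and, when $\operatorname{Var}S=\mathbb E S$, $\mathrm{NB}(\infty,1)$ is understood as the Poisson distribution with parameter $\mathbb E S$. 2. If $\operatorname{Var}S<\mathbb E S$, let $$\tilde m=\frac{(\mathbb E S)^2}{\mathbb E S-\operatorname{Var}S},\qquad m=\lfloor\tilde m\rfloor,\qquad \theta=\frac{np}{m},$$ and suppose that $\theta<1$ (so that the binomial distribution $\mathrm{Bi}(m,\theta)$ is defined). Then $$d_{\mathrm{TV}}(\mathcal L S,\mathrm{Bi}(m,\theta))\le\left(\frac{|p-\theta|}{1-\theta}C_1+\frac{|\beta-\alpha|}{1-\theta}C_2\right)\left[\frac{2K_1}{\sqrt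 n}+\frac{4K_2}{n}+(\beta\vee\alpha)^{\lfloor n/4\rfloor}\right]+\frac{\theta^2(\tilde m-m)}{np(1-\theta)}.$$
   Context: Notation: $a\vee b=\max(a,b)$; $\lfloor x\rfloor$ is the integer part of $x$; $\mathbb Z_+=\{0,1,2,\dots\}$. Stationarity of $\mathbf X$ means that $X_1$ (hence every $X_i$) has the stationary distribution $\pi(1)=p=\frac{\alpha}{1-\beta+\alpha}$, $\pi(0)=\frac{1-\beta}{1-\beta+\alpha}$. For probability distributions $P,Q$ on $\mathbb Z_+$, $d_{\mathrm{TV}}(P,Q)=\sup_{A\subset\mathbb Z_+}|P(A)-Q(A)|$. $\mathrm{Bi}(m,\theta)$ is the binomial distribution with $m$ trials and success probability $0<\theta<1$. For $r>0$ and $0<q<1$, $Y$ has the negative binomial distribution $\mathrm{NB}(r,q)$ if $\mathbb P(Y=k)=\frac{\Gamma(r+k)}{\Gamma(r)k!}q^r(1-q)^k$ for $k\in\mathbb Z_+$. Constants: $$\mu_1=\frac{1-\alpha}{\alpha},\quad \sigma_1^2=\frac{1-\alpha}{\alpha^2},\quad \mu_2=\frac{\beta}{1-\beta},\quad \sigma_2^2=\frac{\beta}{(1-\beta)^2},$$ $$C_0=\frac{|\beta-\alpha|\,(5+43(\alpha\vee\beta))}{(1-\beta\vee\alpha)^2},\quad C_1=\frac{10(\beta\vee\alpha)}{1-\beta\vee\alpha},\quad C_2=\frac{(1-p)(5+23(\alpha\vee\beta))}{(1-\alpha\vee\beta)^2},$$ $$K_1=\sqrt5\,\sqrt{\frac{\mu_1+\mu_2+2}{\min(1-\alpha,\beta,1/2)}},\qquad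 K_2=\frac{90(\sigma_1^2+\sigma_2^2)}{\mu_1+\mu_2+2}.$$ *)

(* Defs.v *)
From HB Require Import structures.
From mathcomp Require Import all_boot all_order all_algebra.
From mathcomp Require Import all_classical all_reals all_analysis.

Set Implicit Arguments.
Unset Strict Implicit.
Unset Printing Implicit Defensive.

Import Order.TTheory GRing.Theory Num.Theory.
Import numFieldNormedType.Exports.

Local Open Scope classical_set_scope.
Local Open Scope ring_scope.

(* Total variation distance between laws on nat, whose sigma-algebra is
   discrete, so that the supremum is over all subsets. *)
Definition dTV {R : realType} (P Q : set nat -> \bar R) : \bar R :=
  ereal_sup [set `|P A - Q A|%E | A in [set: set nat]].

Definition Gamma {R : realType} (s : R) : R :=
  \int[lebesgue_measure]_(x in `]0, +oo[) (x `^ (s - 1) * expR (- x)).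

(* Meaningful for 0 < r and 0 < q < 1. *)
Definition nbinom_pmf {R : realType} (r q : R) (k : nat) : R :=
  Gamma (r + k%:R) / (Gamma r * k`!%:R) * (q `^ r) * (1 - q) ^+ k.

Definition nbinom_prob {R : realType} (r q : R) : set nat -> \bar R :=
  fun A => (\esum_(k in A) (nbinom_pmf r q k)%:E)%E.

Section two_state_chain.
Context {d : measure_display} {T : measurableType d} {R : realType}.
Variable P : probability T R.

Definition cond_prob (A B : set T) : R := fine (P (A `&` B)) / fine (P B).

(* The states 0 and 1 are false and true; X_1, ..., X_n are indexed by
   0, ..., n - 1. *)
Definition markov_chain (n : nat) (X : 'I_n -> {RV P >-> bool})
    (Q : bool -> bool -> R) : Prop :=
  forall (i j : 'I_n) (x : 'I_n -> bool), j = i.+1 :> nat ->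
  let past := [set w | forall l : 'I_n, (l <= i)%N -> X l w = x l] in
  P past != 0%E ->
  cond_prob [set w | X j w = x j] past = Q (x i) (x j).

Definition initial_law (n : nat) (X : 'I_n -> {RV P >-> bool})
    (pi0 : bool -> R) : Prop :=
  forall (i : 'I_n) (b : bool), i = 0%N :> nat ->
  P [set w | X i w = b] = (pi0 b)%:E.

End two_state_chain.

Section chain_sum.
Context {d : measure_display} {T : measurableType d}.

Definition chain_sum (n : nat) (X : 'I_n -> {mfun T >-> bool}) (w : T) : nat :=
  (\sum_(i < n) nat_of_bool (X i w))%N.

Lemma measurable_chain_sum n (X : 'I_n -> {mfun T >-> bool}) :
  measurable_fun [set: T] (chain_sum X).
Proof.
rewrite /chain_sum; elim: n X => [|n IH] X.
  by apply: (eq_measurable_fun (cst 0%N)) => // w _; rewrite big_ord0.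
apply: (eq_measurable_fun (fun w => nat_of_bool (X ord0 w)
    + \sum_(i < n) nat_of_bool (X (lift ord0 i) w))%N) => [w _|].
  by rewrite big_ord_recl.
apply: measurable_realfun.measurable_fun_addn; last exact: (IH (fun i => X (lift ord0 i))).
by apply: (@measurableT_comp _ _ _ _ _ _ nat_of_bool) => //.
Qed.

HB.instance Definition _ n (X : 'I_n -> {mfun T >-> bool}) :=
  isMeasurableFun.Build _ _ _ _ (chain_sum X) (measurable_chain_sum X).

End chain_sum.

Section constants.
Context {R : realType}.
Variables alpha beta : R.

Definition transition (x y : bool) : R :=
  if x then (if y then beta else 1 - beta)
  else (if y then alpha else 1 - alpha).

Definition p1 : R := alpha / (1 - beta + alpha).

Definition stationary_law (b : bool) : R :=
  if b then p1 else (1 - beta) / (1 - beta + alpha).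

Definition mu1 : R := (1 - alpha) / alpha.
Definition sigma1sq : R := (1 - alpha) / alpha ^+ 2.
Definition mu2 : R := beta / (1 - beta).
Definition sigma2sq : R := beta / (1 - beta) ^+ 2.

Local Notation ab := (Num.max alpha beta).

Definition C0 : R := `|beta - alpha| * (5 + 43 * ab) / (1 - ab) ^+ 2.
Definition C1 : R := 10 * ab / (1 - ab).
Definition C2 : R := (1 - p1) * (5 + 23 * ab) / (1 - ab) ^+ 2.

Definition K1 : R :=
  Num.sqrt 5 *
  Num.sqrt ((mu1 + mu2 + 2) / Num.min (Num.min (1 - alpha) beta) (1 / 2)).
Definition K2 : R := 90 * (sigma1sq + sigma2sq) / (mu1 + mu2 + 2).

End constants.

(* Main.v *)
Require Import Defs.
From mathcomp Require Import all_boot all_order all_algebra.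
From mathcomp Require Import ring lra zify.
From mathcomp Require Import all_classical all_reals all_analysis.
From mathcomp Require Import measurable_realfun.

Set Implicit Arguments.
Unset Strict Implicit.
Unset Printing Implicit Defensive.

Import Order.TTheory GRing.Theory Num.Theory.
Import numFieldNormedType.Exports.

Local Open Scope classical_set_scope.
Local Open Scope ring_scope.

(** The proof is Stein's method, in a form common to the three approximating laws.
  A Poisson, negative binomial or binomial law of mean [mu] is the stationary law
  of a birth-death chain with rates [mu - theta * k] and [(1 - theta) * k], where
  [1 - theta] is its ratio of variance to mean.  The associated Stein equation has
  a solution [g] whose increments are at most [1 / mu] when [theta <= 0] and
  [1 / (mu * (1 - theta))] for a binomial law ([stein_bounded_full],
  [stein_bounded_binomial], from [stein_sol_increment]), so a total variation
  distance is bounded by the expectation of the Stein operator under the law of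
  [S] ([dTV_stein]).

  That expectation is computed from two identities for the stationary chain.  By
  reversibility, given [X_i] the past and the future of [i] are independent copies
  of the chain started at [X_i] ([stat_exp_split]), and [S g(S)] is a sum over the
  times [i] with [X_i = 1] ([stat_exp_size_bias]).  The error becomes a sum over
  [i] of differences of expectations of [g] under the laws of [S - X_i] given
  [X_i = 1] and given [X_i = 0] ([stein_expE]).  The effect of a state on later
  sums decays like the powers of [beta - alpha], the second eigenvalue
  ([chain_op_init]), so these differences are geometric series of expectations of
  increments of [g].  Replacing every increment by the same mean increment leaves
  a first order term, which is the mismatch between the variance of [S] and that
  of the approximating law ([first_orderE]): zero for the Poisson and negative
  binomial laws, and a rounding effect for the binomial law.

  What remains are second differences: expectations of the increments of a bounded
  function under sums of the chain over at least about three quarters of the time.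
  The terms of the geometric series that leave a shorter piece carry a weight
  [|beta - alpha| ^ (n / 4)].  Here smoothness is needed.  Observe the chain at
  even times.  Between two different states the middle state is a Bernoulli
  variable with the same parameter for both orders, so given the even states [S]
  contains an independent binomial variable, and integration by parts for it
  ([iter_bern_by_parts]) gives a bound [1 / sqrt (v * number of switches)].  The
  mean of the inverse of the number of switches is bounded by a drift argument for
  the two-state chain of even states ([inv_drift], [chain_op_smooth_aux]), which
  yields the order [K1 / sqrt n] ([smoothness_long], [chain_op_smooth2]).

  The conditional laws are represented by [chain_op], the iterated transition
  operator on functions of the state and of a counter; this makes all the above
  identities inductions on the number of steps. *)

(** * The Gamma function *)

Section gamma_function.
Context {R : realType}.
Implicit Types s a b x : R.
Local Notation mu := (@lebesgue_measure R).

Definition gamma_fun s x : R := x `^ (s - 1) * expR (- x).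

(** Extended-real valued, because the functional equation is established before
  finiteness and is what gives finiteness for [s < 1]. *)
Definition egamma s : \bar R :=
  (\int[mu]_(x in `]0%R, +oo[) (gamma_fun s x)%:E)%E.

Lemma gamma_fun_ge0 s x : 0 <= gamma_fun s x.
Proof. by rewrite mulr_ge0 ?powR_ge0 ?expR_ge0. Qed.

Lemma measurable_gamma_fun s (D : set R) :
  measurable_fun D (fun x : R => (gamma_fun s x)%:E).
Proof.
apply/measurable_EFinP; apply: measurable_funTS; apply: measurable_funM.
  exact: measurable_powR.
by apply: measurableT_comp => //; exact: measurable_expR.
Qed.

Lemma egamma_ge0 s : (0 <= egamma s)%E.
Proof. by apply: integral_ge0 => x _; rewrite lee_fin gamma_fun_ge0. Qed.

Lemma derivable_oo_LRcontinuousW (f : R -> R) a b : a < b ->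
  (forall x, a <= x -> derivable f x 1) -> derivable_oo_LRcontinuous f a b.
Proof.
move=> ab df.
have cf x : a <= x -> {for x, continuous f}.
  by move=> ax; apply/differentiable_continuous/derivable1_diffP/df.
split.
- by move=> x; rewrite in_itv/= => /andP[ax _]; apply: df; exact: ltW.
- by apply: cvg_at_right_filter; exact: cf.
- by apply: cvg_at_left_filter; apply: cf; exact: ltW.
Qed.

Lemma gamma_fun_by_parts s a b : 0 < a -> a < b ->
  (\int[mu]_(x in `[a, b]) (gamma_fun (s + 1) x)%:E =
   (a `^ s * expR (- a) - b `^ s * expR (- b))%:E +
   s%:E * \int[mu]_(x in `[a, b]) (gamma_fun s x)%:E)%E.
Proof.
move=> a0 ab.
have dpow c x : a <= x -> derivable (fun y : R => y `^ c) x 1.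
  move=> ax; apply: derivable_powR.
  by rewrite in_itv/= andbT (lt_le_trans a0 ax).
have dexp x : is_derive x 1 (fun y : R => - expR (- y)) (expR (- x)).
  have := is_deriveN (is_derive1_comp
    (is_derive_expR (- x)) (is_deriveN (is_derive_id x 1))).
  by move=> /is_derive_eq; apply; rewrite mulrN1 opprK.
have dexp2 x : derivable (fun y : R => expR (- y)) x 1.
  apply/derivable1_diffP; apply: differentiable_comp => //.
  exact/derivable1_diffP.
have cw (f : R -> R) : (forall x, a <= x -> derivable f x 1) ->
    {within `[a, b], continuous f}.
  move=> df; apply: derivable_within_continuous => x.
  by rewrite in_itv/= => /andP[ax _]; exact: df.
have cf : {within `[a, b], continuous (fun x => s * x `^ (s - 1))}.
  by apply: cw => x ax; apply: derivableM => //; exact: dpow.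
have cg : {within `[a, b], continuous (fun x : R => expR (- x))}.
  by apply: cw.
have Fab : derivable_oo_LRcontinuous (fun x => x `^ s) a b.
  by apply: derivable_oo_LRcontinuousW => // x ax; exact: dpow.
have Gab : derivable_oo_LRcontinuous (fun x => - expR (- x)) a b.
  by apply: derivable_oo_LRcontinuousW => // x ax; case: (dexp x).
have Ff : {in `]a, b[, (fun x => x `^ s)^`()%classic =1 (fun x => s * x `^ (s - 1))}.
  move=> x; rewrite in_itv/= => /andP[ax _].
  by apply: powR_derive1; rewrite in_itv/= andbT (lt_trans a0 ax).
have Gg : {in `]a, b[, (fun x => - expR (- x))^`()%classic =1 (fun x => expR (- x))}.
  by move=> x _; rewrite derive1E; case: (dexp x).
have := integration_by_parts ab cf Fab Ff cg Gab Gg.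
have -> : (\int[mu]_(x in `[a, b]) (gamma_fun (s + 1) x)%:E =
   \int[mu]_(x in `[a, b]) (x `^ s * expR (- x))%:E)%E.
  by apply: eq_integral => x _; rewrite /gamma_fun addrK.
move=> ->.
have -> : (\int[mu]_(x in `[a, b]) (s * x `^ (s - 1) * - expR (- x))%:E =
  \int[mu]_(x in `[a, b]) (((- s)%:E) * (gamma_fun s x)%:E))%E.
  by apply: eq_integral => x _; rewrite /gamma_fun -EFinM; congr EFin; ring.
rewrite integralZl//; last first.
  apply: continuous_compact_integrable; first exact: segment_compact.
  by apply: cw => x ax; apply: derivableM; [exact: dpow|exact: dexp2].
rewrite EFinN mulNe oppeK; congr (_ + _)%E; congr EFin; ring.
Qed.

(** The boundary terms of the integration by parts vanish at infinity, because
  the exponential series dominates every power. *)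
Lemma cvg_powR_expRN s :
  (fun n : nat => (n.+2%:R : R) `^ s * expR (- n.+2%:R)) @ \oo --> (0 : R).
Proof.
have [N sN] : exists N : nat, s <= N%:R.
  by exists (Num.truncn s).+1; rewrite ltW// truncnS_gt.
apply: (@squeeze_cvgr _ _ _ _ (fun=> 0)
          (fun n : nat => (N.+1)`!%:R * n.+1%:R^-1 : R)).
- near=> n; apply/andP; split; first by rewrite mulr_ge0 ?powR_ge0 ?expR_ge0.
  have x1 : 1 <= n.+2%:R :> R by rewrite ler1n.
  have x0 : 0 < n.+2%:R :> R by rewrite ltr0n.
  have ex : 1 + n.+2%:R ^+ N.+1 / (N.+1)`!%:R <= expR (n.+2%:R : R).
    by apply: expR_ge1Dxn; exact: ltW.
  have f0 : 0 < (N.+1)`!%:R :> R by rewrite ltr0n fact_gt0.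
  rewrite expRN ler_pdivrMr ?expR_gt0//.
  apply: (@le_trans _ _ (n.+2%:R ^+ N)).
    by rewrite -powR_mulrn ?(ltW x0)//; apply: ler_powR.
  apply: (@le_trans _ _ ((N.+1)`!%:R / n.+1%:R *
      (n.+2%:R ^+ N.+1 / (N.+1)`!%:R))).
    rewrite exprS [leRHS](_ : _ = n.+2%:R ^+ N * (n.+2%:R / n.+1%:R)).
      by rewrite ler_peMr ?exprn_ge0// ler_pdivlMr ?ltr0n// mul1r ler_nat.
    by field; rewrite gt_eqF//= -natr1; split=> //; rewrite gt_eqF// ltr_pwDr.
  rewrite ler_wpM2l ?divr_ge0// (le_trans _ ex)// lerDr//.
- exact: cvg_cst.
- rewrite -[X in _ --> X](mulr0 (N.+1)`!%:R); apply: cvgMr.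
  exact: cvg_harmonic.
Unshelve. all: by end_near. Qed.

(** Compact intervals exhausting the open half line, away from 0 where the
  integrand is singular when [s < 1]. *)
Let gitv (n : nat) : set R := `[(n.+2%:R)^-1, n.+2%:R].

Lemma cvg_egamma s :
  (\int[mu]_(x in gitv n) (gamma_fun s x)%:E)%E
    @[n --> \oo] --> egamma s.
Proof.
have -> : egamma s = (\int[mu]_(x in \bigcup_n gitv n) (gamma_fun s x)%:E)%E.
  congr (integral _ _ _); apply/seteqP; split => x /=.
  - rewrite in_itv/= andbT => x0.
    exists (Num.truncn (x + x^-1)) => //=.
    have tx := truncnS_gt (x + x^-1).
    have xV0 : 0 < x^-1 by rewrite invr_gt0.
    have n2 : (Num.truncn (x + x^-1)).+1%:R <=
              (Num.truncn (x + x^-1)).+2%:R :> R by rewrite ler_nat.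
    rewrite /gitv/= in_itv/=; apply/andP; split; last lra.
    rewrite -[leRHS]invrK lef_pV2 ?posrE ?invr_gt0 ?ltr0n//; lra.
  - move=> [n _]; rewrite /gitv /= !in_itv/= andbT => /andP[+ _].
    by apply: lt_le_trans; rewrite invr_gt0 ltr0n.
apply: ge0_nondecreasing_set_cvg_integral.
- move=> m n mn; apply/subsetPset => x; rewrite /gitv/= !in_itv/= => /andP[h1 h2].
  apply/andP; split.
  + by apply: le_trans h1; rewrite lef_pV2 ?posrE ?ltr0n// ler_nat !ltnS.
  + by apply: (le_trans h2); rewrite ler_nat !ltnS.
- by move=> n; exact: measurable_itv.
- by move=> n; exact: measurable_gamma_fun.
- by move=> n x _; rewrite lee_fin gamma_fun_ge0.
Qed.

Lemma egammaS s : 0 < s -> egamma (s + 1) = (s%:E * egamma s)%E.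
Proof.
move=> s0.
suff h : (\int[mu]_(x in gitv n) (gamma_fun (s + 1) x)%:E)%E @[n --> \oo]
    --> (s%:E * egamma s)%E.
  exact: (cvg_unique _ (@cvg_egamma (s + 1)) h).
have -> : (fun n : nat => \int[mu]_(x in gitv n)
    (gamma_fun (s + 1) x)%:E)%E =
  (fun n : nat => ((n.+2%:R^-1) `^ s * expR (- (n.+2%:R^-1)) -
     n.+2%:R `^ s * expR (- n.+2%:R))%:E +
   s%:E * \int[mu]_(x in gitv n) (gamma_fun s x)%:E)%E.
  apply/funext => n; rewrite gamma_fun_by_parts// ?invr_gt0 ?ltr0n//.
  apply: (@lt_trans _ _ 1); last by rewrite ltr1n.
  by rewrite invf_lt1 ?ltr0n// ltr1n.
rewrite -[X in _ --> X]add0e.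
apply: cvgeD => //.
- apply: cvg_EFin; first by apply: nearW.
  rewrite -[X in _ --> X](subr0 0); apply: cvgB; last exact: cvg_powR_expRN.
  apply: (@squeeze_cvgr _ _ _ _ (fun=> 0)
          (fun n : nat => (n.+2%:R^-1) `^ s : R)).
  + apply: nearW => n; rewrite mulr_ge0 ?powR_ge0 ?expR_ge0//=.
    by rewrite ler_piMr ?powR_ge0// expR_le1 oppr_le0 invr_ge0.
  + exact: cvg_cst.
  + apply: (@cvg_comp _ _ _ (fun n : nat => (n.+2%:R^-1 : R))
       (fun x => x `^ s) _ (0^'+) _ _ (powR_cvg0 s0)).
    have /cvgrPdist_lt h : (n.+2%:R^-1 : R) @[n --> \oo] --> 0.
      have := @cvg_harmonic R; rewrite -cvg_shiftS; exact: cvg_trans.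
    move=> A [e /= e0 Ae]; have := h e e0; apply: filterS => n hn.
    by apply: Ae => //=; rewrite invr_gt0 ltr0n.
- by apply: cvgeZl => //; exact: cvg_egamma.
Qed.


(** The integrand is dominated by a multiple of the exponential density of rate
  1/2. *)
Lemma egamma_fin1 s : 1 <= s -> (egamma s < +oo)%E.
Proof.
move=> s1.
have [N sN] : exists N : nat, s - 1 <= N%:R.
  by exists (Num.truncn (s - 1)).+1; rewrite ltW// truncnS_gt.
pose C : R := 1 + (N.+1)`!%:R * 2 ^+ N.+1.
have C0 : 0 <= C by rewrite addr_ge0// mulr_ge0// exprn_ge0.
have bound x : 0 < x -> gamma_fun s x <= (2 * C) * exponential_pdf (2^-1) x.
  move=> x0.
  rewrite /exponential_pdf patchE mem_set/=; last by rewrite in_itv/= ltW.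
  have -> : 2 * C * (2^-1 * expR (- 2^-1 * x)) = C * expR (- 2^-1 * x) by field.
  have -> : gamma_fun s x =
      (x `^ (s - 1) * expR (- (x / 2))) * expR (- 2^-1 * x).
    by rewrite -mulrA -expRD; congr (_ * expR _); field.
  rewrite ler_wpM2r ?expR_ge0// expRN ler_pdivrMr ?expR_gt0//.
  have y0 : 0 <= x / 2 by lra.
  have [x1|x1] := leP x 1.
    apply: (@le_trans _ _ 1).
      apply: (@le_trans _ _ (1 `^ (s - 1))); last by rewrite powR1.
      by rewrite ge0_ler_powR ?nnegrE// ?subr_ge0// ltW.
    have C1 : 1 <= C by rewrite /C lerDl mulr_ge0// exprn_ge0.
    have e1 : 1 <= expR (x / 2) by rewrite (le_trans _ (expR_ge1Dx _))// lerDl.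
    by rewrite (le_trans C1)// ler_peMr.
  apply: (@le_trans _ _ (x ^+ N.+1)).
    rewrite -powR_mulrn ?(ltW x0)//; apply: ler_powR; first exact: ltW.
    by rewrite (le_trans sN)// ler_nat.
  have ex : 1 + (x / 2) ^+ N.+1 / (N.+1)`!%:R <= expR (x / 2).
    exact: expR_ge1Dxn.
  have f0 : 0 < (N.+1)`!%:R :> R by rewrite ltr0n fact_gt0.
  apply: (@le_trans _ _ ((N.+1)`!%:R * 2 ^+ N.+1 *
      ((x / 2) ^+ N.+1 / (N.+1)`!%:R))).
    rewrite expr_div_n le_eqVlt; apply/orP; left; apply/eqP.
    by field; rewrite !gt_eqF// exprn_gt0.
  apply: ler_pM; rewrite ?mulr_ge0 ?exprn_ge0 ?invr_ge0 ?(ltW f0)//.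
    by rewrite /C lerDr.
  by apply: le_trans ex; rewrite lerDr.
apply: (@le_lt_trans _ _ (\int[mu]_(x in `]0%R, +oo[)
    ((2 * C)%:E * (exponential_pdf (2^-1) x)%:E)))%E.
  apply: ge0_le_integral => //.
  - by move=> x _; rewrite lee_fin gamma_fun_ge0.
  - exact: measurable_gamma_fun.
  - apply: measurable_funTS; apply: measurable_funeM.
    by apply/measurable_EFinP; exact: measurable_exponential_pdf.
  - by move=> x; rewrite /= in_itv/= andbT => x0; rewrite -EFinM lee_fin bound.
have pdf0 x : (0 <= (exponential_pdf (2^-1) x)%:E :> \bar R)%E.
  by rewrite lee_fin exponential_pdf_ge0.
have mpdf (D : set R) : measurable_fun D
    (fun x : R => (exponential_pdf (2^-1) x)%:E : \bar R).
  apply: measurable_funTS; apply/measurable_EFinP.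
  exact: measurable_exponential_pdf.
rewrite ge0_integralZl//; last by rewrite lee_fin mulr_ge0.
  2: exact: mpdf.
apply: (@le_lt_trans _ _ ((2 * C)%:E * 1%:E)%E); last by rewrite -EFinM ltry.
apply: lee_wpmul2l; first by rewrite lee_fin mulr_ge0.
apply: (@le_trans _ _ (\int[mu]_x (exponential_pdf (2^-1) x)%:E)%E).
  apply: ge0_subset_integral => //; exact: mpdf.
by rewrite integral_exponential_pdf.
Qed.

Lemma egamma_fin s : 0 < s -> (egamma s < +oo)%E.
Proof.
move=> s0.
have : (egamma (s + 1) < +oo)%E by apply: egamma_fin1; rewrite lerDr ltW.
rewrite egammaS//; have := egamma_ge0 s; case: (egamma s) => [x _ _|_|//]; first exact: ltry.
by rewrite gt0_muley.
Qed.

Lemma GammaE s : Gamma s = fine (egamma s).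
Proof. by []. Qed.

(** The functional equation reduces every quotient of Gamma values in the
  negative binomial weights to a finite product. *)
Lemma GammaS s : 0 < s -> Gamma (s + 1) = s * Gamma s.
Proof.
move=> s0; rewrite !GammaE egammaS// fineM//.
by rewrite ge0_fin_numE ?egamma_ge0// egamma_fin.
Qed.

Lemma Gamma_gt0 s : 0 < s -> 0 < Gamma s.
Proof.
suff h (t : R) : 1 <= t -> 0 < Gamma t.
  move=> s0; have : 0 < Gamma (s + 1) by apply: h; rewrite lerDr ltW.
  by rewrite GammaS// pmulr_rgt0.
move=> t1; have t0 : 0 < t by apply: lt_le_trans t1.
rewrite GammaE fine_gt0// egamma_fin// andbT.
apply: (@lt_le_trans _ _ (\int[mu]_(x in `[1%R, 2%R]) (expR (- 2))%:E)%E).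
  rewrite integral_cst//= lebesgue_measure_itv/= lte_fin ltr1n -EFinB -EFinM.
  by rewrite lte_fin mulr_gt0 ?expR_gt0//; lra.
apply: (@le_trans _ _ (\int[mu]_(x in `[1%R, 2%R]) (gamma_fun t x)%:E)%E).
  apply: ge0_le_integral => //.
  - exact: measurable_gamma_fun.
  - move=> x; rewrite /= in_itv/= => /andP[x1 x2].
    rewrite lee_fin /gamma_fun -[leLHS]mul1r ler_pM ?expR_ge0//.
      apply: (@le_trans _ _ (x `^ 0)); first by rewrite powRr0.
      by apply: ler_powR => //; rewrite subr_ge0.
    by rewrite ler_expR lerN2.
apply: ge0_subset_integral => //.
- exact: measurable_gamma_fun.
- by move=> x _; rewrite lee_fin gamma_fun_ge0.
- by move=> x /=; rewrite !in_itv/= andbT => /andP[x1 _]; exact: lt_le_trans x1.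
Qed.

End gamma_function.

(** * The negative binomial weights *)

Section negative_binomial.
Context {R : realType}.
Implicit Types r q x : R.

Definition nbinom_coeff r (k : nat) : R := Gamma (r + k%:R) / (Gamma r * k`!%:R).

Lemma nbinom_pmfE r q k :
  nbinom_pmf r q k = nbinom_coeff r k * (q `^ r) * (1 - q) ^+ k.
Proof. by []. Qed.

Lemma nbinom_coeff_gt0 r k : 0 < r -> 0 < nbinom_coeff r k.
Proof.
move=> r0; have f0 : 0 < k`!%:R :> R by rewrite ltr0n fact_gt0.
by rewrite divr_gt0 ?mulr_gt0 ?Gamma_gt0// ltr_wpDr.
Qed.

Lemma nbinom_coeff0 r : 0 < r -> nbinom_coeff r 0 = 1.
Proof.
by move=> r0; rewrite /nbinom_coeff addr0 fact0 mulr1 divff// gt_eqF// Gamma_gt0.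
Qed.

Lemma nbinom_coeffS r k : 0 < r ->
  k.+1%:R * nbinom_coeff r k.+1 = (r + k%:R) * nbinom_coeff r k.
Proof.
move=> r0; rewrite /nbinom_coeff factS natrM -[in r + k.+1%:R]natr1 addrA.
have f0 : k`!%:R != 0 :> R by rewrite pnatr_eq0 -lt0n fact_gt0.
have g0 : Gamma r != 0 by rewrite gt_eqF// Gamma_gt0.
have k0 : 1 + k%:R != 0 :> R by rewrite nat1r pnatr_eq0.
rewrite GammaS ?ltr_wpDr//; field.
by rewrite f0 g0 ?k0.
Qed.

Lemma nbinom_coeff_shift r k : 0 < r ->
  r * nbinom_coeff (r + 1) k = (r + k%:R) * nbinom_coeff r k.
Proof.
move=> r0; rewrite /nbinom_coeff addrAC !GammaS ?ltr_wpDr//.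
have f0 : k`!%:R != 0 :> R by rewrite pnatr_eq0 -lt0n fact_gt0.
have g0 : Gamma r != 0 by rewrite gt_eqF// Gamma_gt0.
by field; rewrite f0 g0 gt_eqF.
Qed.

(** Each term contributes the difference of two neighbouring beta densities, so
  the derivative in [q] of a partial sum telescopes to a single term. *)
Lemma is_derive_nbinom_sum r K x : 0 < r -> 0 < x ->
  is_derive x 1 (fun y => \sum_(k < K.+1) nbinom_coeff r k * y `^ r * (1 - y) ^+ k)
    ((r + K%:R) * nbinom_coeff r K * x `^ (r - 1) * (1 - x) ^+ K).
Proof.
move=> r0 x0; elim: K => [|K IH].
  have := is_deriveZ (nbinom_coeff r 0) (is_derive1_powR r x0).
  set f := (X in is_derive _ _ X _).
  rewrite (_ : f = (fun y => \sum_(k < 1) nbinom_coeff r k * y `^ r * (1 - y) ^+ k)).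
    by move/is_derive_eq; apply; rewrite expr0 addr0 mulr1 /GRing.scale/=; ring.
  by apply/funext => y; rewrite big_ord1 expr0 mulr1.
have d1 : is_derive x 1 (fun y : R => 1 - y) (-1).
  have := is_deriveB (is_derive_cst (1 : R) x 1) (is_derive_id x 1).
  by move=> /is_derive_eq; apply; rewrite sub0r.
have dX : is_derive x 1 (fun y : R => (1 - y) ^+ K.+1)
    (- (K.+1%:R * (1 - x) ^+ K)).
  have := is_deriveX K.+1 d1; rewrite exprfctE => /is_derive_eq; apply.
  by rewrite /GRing.scale/= mulrN1.
have dM := is_deriveM (is_derive1_powR r x0) dX.
have := is_deriveD IH (is_deriveZ (nbinom_coeff r K.+1) dM).
set f := (X in is_derive _ _ X _).
rewrite (_ : f = (fun y => \sum_(k < K.+2) nbinom_coeff r k * y `^ r * (1 - y) ^+ k)).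
  move/is_derive_eq; apply.
  have e : x * x `^ (r - 1) = x `^ r by rewrite mulr_powRB1// ltW.
  have h := nbinom_coeffS K r0.
  rewrite /GRing.scale/= -e.
  have -> : (r + K%:R) * nbinom_coeff r K = K.+1%:R * nbinom_coeff r K.+1 by [].
  by rewrite exprS -natr1; ring.
apply/funext => y; rewrite [RHS]big_ord_recr/=; congr (_ + _).
by rewrite -mulrA.
Qed.

Lemma nbinom_sum_mvt r q K : 0 < r -> 0 < q < 1 ->
  exists2 c, q < c < 1 &
  1 - \sum_(k < K.+1) nbinom_pmf r q k =
  (r + K%:R) * nbinom_coeff r K * c `^ (r - 1) * (1 - c) ^+ K * (1 - q).
Proof.
move=> r0 /andP[q0 q1].
pose f y := \sum_(k < K.+1) nbinom_coeff r k * y `^ r * (1 - y) ^+ k.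
have df y : q <= y -> is_derive y 1 f
    ((r + K%:R) * nbinom_coeff r K * y `^ (r - 1) * (1 - y) ^+ K).
  by move=> qy; apply: is_derive_nbinom_sum => //; exact: lt_le_trans qy.
have [||c cq h] := MVT q1 (f := f)
   (df := fun y => (r + K%:R) * nbinom_coeff r K * y `^ (r - 1) * (1 - y) ^+ K).
- by move=> y; rewrite in_itv/= => /andP[qy _]; apply: df; exact: ltW.
- apply: derivable_within_continuous => y; rewrite in_itv/= => /andP[qy _].
  by case: (df y qy).
exists c; first by move: cq; rewrite in_itv.
rewrite -h; congr (_ - _); rewrite /f big_ord_recl big1 ?addr0 => [|i _].
  by rewrite expr0 powR1 nbinom_coeff0// !mulr1.
by rewrite subrr expr0n mulr0.
Qed.

Lemma nbinom_pmf_ge0 r q k : 0 < r -> 0 < q < 1 -> 0 <= nbinom_pmf r q k.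
Proof.
move=> r0 /andP[q0 q1]; have a0 := ltW (nbinom_coeff_gt0 k r0).
rewrite nbinom_pmfE; apply: mulr_ge0; last by rewrite exprn_ge0// subr_ge0 ltW.
by apply: mulr_ge0 => //; exact: powR_ge0.
Qed.

Lemma nbinom_sum_le1 r q K : 0 < r -> 0 < q < 1 ->
  \sum_(0 <= k < K) nbinom_pmf r q k <= 1.
Proof.
move=> r0 q01; case: K => [|K]; first by rewrite big_geq.
rewrite big_mkord -subr_ge0; have [c /andP[_ c1] ->] := nbinom_sum_mvt K r0 q01.
case/andP: q01 => q0 q1.
have a0 := ltW (nbinom_coeff_gt0 K r0).
have b0 : 0 <= r + K%:R by rewrite addr_ge0// ltW.
move: (nbinom_coeff r K) a0 => A a0.
by rewrite !mulr_ge0 ?powR_ge0 ?exprn_ge0 ?subr_ge0 ?(ltW c1) ?(ltW q1).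
Qed.

Lemma nbinom_series_cvg r q : 0 < r -> 0 < q < 1 -> cvgn (series (nbinom_pmf r q)).
Proof.
move=> r0 q01; apply: nondecreasing_is_cvgn.
  apply/nondecreasing_seqP => n; rewrite seriesSr lerDl; exact: nbinom_pmf_ge0.
exists 1 => _ [n _ <-]; exact: nbinom_sum_le1.
Qed.

(** The negative binomial weights have total mass one: the missing mass is of
  the order of a weight of the law with parameter r + 1, and these are the terms
  of a convergent series. *)
Lemma nbinom_series r q : 0 < r -> 0 < q < 1 ->
  series (nbinom_pmf r q) @ \oo --> (1 : R).
Proof.
move=> r0 q01; have /andP[q0 q1] := q01.
rewrite -cvg_shiftS.
pose C := q^-1 * (r / (q * q `^ r)).
have r1 : 0 < r + 1 by rewrite ltr_wpDr.
apply: (@squeeze_cvgr _ _ _ _ (fun n => 1 - C * nbinom_pmf (r + 1) q n) (fun=> 1)).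
- apply: nearW => n; rewrite nbinom_sum_le1// andbT lerBlDr -lerBlDl.
  rewrite /series/= big_mkord; have [c /andP[qc c1] ->] := nbinom_sum_mvt n r0 q01.
  have c0 : 0 < c by apply: lt_trans qc.
  have -> : C * nbinom_pmf (r + 1) q n =
      (r + n%:R) * nbinom_coeff r n * (q^-1 * (1 - q) ^+ n).
    rewrite nbinom_pmfE -nbinom_coeff_shift// /C.
    have -> : q `^ (r + 1) = q * q `^ r.
      by rewrite powRD ?powRr1 ?(ltW q0)// 1?mulrC//; apply/implyP => _; rewrite gt_eqF.
    by field; rewrite !gt_eqF// powR_gt0.
  have k0 : 0 <= (r + n%:R) * nbinom_coeff r n.
    have a0 := ltW (nbinom_coeff_gt0 n r0).
    by apply: mulr_ge0 => //; rewrite addr_ge0// ltW.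
  move: ((r + n%:R) * nbinom_coeff r n) k0 => A A0.
  rewrite -!mulrA ler_wpM2l//.
  have e : c * c `^ (r - 1) = c `^ r by rewrite mulr_powRB1// ltW.
  have -> : c `^ (r - 1) = c^-1 * c `^ r by rewrite -e mulKf// gt_eqF.
  rewrite -mulrA; apply: ler_pM; rewrite ?invr_ge0 ?(ltW c0)//.
  + by rewrite !mulr_ge0 ?powR_ge0 ?exprn_ge0// subr_ge0 ltW.
  + by rewrite lef_pV2 ?posrE// ltW.
  + rewrite -[leRHS]mul1r; apply: ler_pM; rewrite ?powR_ge0//.
    * by rewrite !mulr_ge0 ?exprn_ge0// subr_ge0 ltW.
    * apply: (@le_trans _ _ (1 `^ r)); last by rewrite powR1.
      by apply: ge0_ler_powR; rewrite ?nnegrE ?ltW.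
    * rewrite -[leRHS]mulr1; apply: ler_pM; rewrite ?exprn_ge0 ?subr_ge0 ?(ltW c1) ?(ltW q1)//.
        by apply: lerXn2r; rewrite ?nnegrE ?subr_ge0 ?(ltW c1) ?(ltW q1)// lerB// ltW.
      by rewrite gerBl ltW.
- rewrite -[X in _ --> X](subr0 1) -(mulr0 C); apply: cvgB; first exact: cvg_cst.
  by apply: cvgMr; apply: cvg_series_cvg_0; exact: nbinom_series_cvg.
- exact: cvg_cst.
Qed.

End negative_binomial.

(** * The Stein equation of a birth-death chain *)

Section stein_equation.
Context {R : realType}.
Variables (mu theta : R) (w : nat -> R).

(** Rates of the birth-death chain on the natural numbers whose stationary law has
  mean [mu] and variance to mean ratio [1 - theta]: a binomial law for
  [0 < theta], Poisson for [theta = 0], negative binomial for [theta < 0]. *)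
Definition birth (k : nat) : R := mu - theta * k%:R.
Definition death (k : nat) : R := (1 - theta) * k%:R.

Hypothesis theta1 : theta < 1.
Hypothesis mu0 : 0 < mu.
Hypothesis w0 : forall k, 0 <= w k.
Hypothesis balance : forall k, birth k * w k = death k.+1 * w k.+1.

Let F (k : nat) : R := \sum_(i < k.+1) w i.
Hypothesis F1 : F @ \oo --> (1 : R).

Let FS k : F k.+1 = F k + w k.+1. Proof. by rewrite /F big_ord_recr. Qed.

Let F0 : F 0 = w 0%N. Proof. by rewrite /F big_ord1. Qed.

Let F_ge0 k : 0 <= F k. Proof. by apply: sumr_ge0 => i _; exact: w0. Qed.

Let F_le1 k : F k <= 1.
Proof.
have nF : nondecreasing_seq F.
  by apply/nondecreasing_seqP => n; rewrite FS lerDl w0.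
rewrite -(cvg_lim (@Rhausdorff R) F1).
by apply: nondecreasing_cvgn_le => //; apply/cvg_ex; exists 1.
Qed.

Let birth_w_ge0 k : 0 <= birth k * w k.
Proof. by rewrite balance !mulr_ge0// subr_ge0 ltW. Qed.

Let birthE k : death k - birth k = k%:R - mu.
Proof. by rewrite /death /birth; ring. Qed.

(** By induction, the right side minus the left side is the sum of the values of
  [F] up to [k].  In other words [F k] over the flux [birth k * w k] is
  nondecreasing in [k]. *)
Lemma left_tail_flux k : birth k.+1 * F k <= death k.+1 * F k.+1.
Proof.
suff h : 0 <= (k.+1%:R - mu) * F k + birth k * w k.
  by rewrite FS mulrDr -balance -subr_ge0 addrAC -mulrBl birthE.
elim: k => [|k IH].
  rewrite F0 /birth; suff -> : (1%:R - mu) * w 0 + (mu - theta * 0%:R) * w 0 = w 0.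
    exact: w0.
  by ring.
rewrite (_ : _ + _ = ((k.+1%:R - mu) * F k + birth k * w k) + F k.+1).
  by rewrite addr_ge0.
by rewrite FS (balance k) /birth /death -[k.+2%:R]natr1; ring.
Qed.

Let right_tail_partial k j :
  (F (k + j) - F k) * (k%:R - mu) <= birth k * w k - birth (k + j) * w (k + j).
Proof.
elim: j => [|j IH]; first by rewrite addn0 !subrr mul0r.
rewrite addnS FS; move: IH; rewrite -(subr_ge0 _ (birth k * w k - _)) => IH.
have e : birth (k + j) * w (k + j) =
    (birth (k + j).+1 + ((k + j).+1%:R - mu)) * w (k + j).+1.
  by rewrite balance -birthE [birth _ + _]addrC subrK.
have e2 : (k + j).+1%:R = k%:R + j.+1%:R :> R by rewrite -addnS natrD.
rewrite -subr_ge0 (_ : _ - _ = (birth k * w k - birth (k + j) * w (k + j)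
    - (F (k + j) - F k) * (k%:R - mu)) + w (k + j).+1 * j.+1%:R).
  by rewrite addr_ge0// mulr_ge0.
by rewrite e e2; ring.
Qed.

(** The partial sums of [(mu - i) * w i] telescope to the flux, so the tail beyond
  [k] is controlled by the total mass alone, without summing the mean. *)
Lemma right_tail_bound k : (1 - F k) * (k%:R - mu) <= birth k * w k.
Proof.
have h : (fun j => (F (j + k)%N - F k) * (k%:R - mu)) @ \oo -->
    (1 - F k) * (k%:R - mu).
  apply: cvgMl; apply: cvgB; last exact: cvg_cst.
  by rewrite cvg_shiftn.
apply: (cvgr_to_le h); apply: nearW => j; rewrite addnC.
by rewrite (le_trans (right_tail_partial k j))// gerBl.
Qed.

(** Counterpart of [left_tail_flux] for the upper tail, which over the flux is
  nonincreasing. *)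
Lemma right_tail_flux k : death k.+1 * (1 - F k.+1) <= birth k.+1 * (1 - F k).
Proof.
rewrite -subr_ge0 (_ : _ - _ = birth k.+1 * w k.+1
  - (1 - F k.+1) * (k.+1%:R - mu)) ?subr_ge0 ?right_tail_bound//.
by rewrite -birthE FS; ring.
Qed.

(** [q] is the probability of the set with indicator [a]. *)
Variables (a : nat -> bool) (q : R).
Let A (k : nat) : R := \sum_(i < k.+1) (a i)%:R * w i.
Hypothesis A_le : forall k, A k <= q.
Hypothesis A_tail : forall k, q - A k <= 1 - F k.

Let AS k : A k.+1 = A k + (a k.+1)%:R * w k.+1.
Proof. by rewrite /A big_ord_recr. Qed.

Let A0 : A 0 = (a 0%N)%:R * w 0%N. Proof. by rewrite /A big_ord1. Qed.

Let A_ge0 k : 0 <= A k.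
Proof. by apply: sumr_ge0 => i _; rewrite mulr_ge0. Qed.

Let A_leF k : A k <= F k.
Proof.
by apply: ler_sum => i _; rewrite ler_piMl//; case: (a i).
Qed.

(** Value at [k.+1] of the bounded solution of the Stein equation. *)
Definition stein_sol (k : nat) : R := (A k - q * F k) / (birth k * w k).

Lemma stein_solE k : 0 < birth k * w k -> 0 < birth k.+1 * w k.+1 ->
  birth k.+1 * stein_sol k.+1 - death k.+1 * stein_sol k = (a k.+1)%:R - q.
Proof.
rewrite (balance k) => h h'; rewrite /stein_sol (balance k) AS FS.
have w1 : w k.+1 != 0 by apply: contraTneq h' => ->; rewrite mulr0 ltxx.
have b1 : birth k.+1 != 0 by apply: contraTneq h' => ->; rewrite mul0r ltxx.
have d1 : death k.+1 != 0 by apply: contraTneq h => ->; rewrite mul0r ltxx.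
by field; rewrite b1 w1 d1.
Qed.

Lemma stein_solE0 : 0 < birth 0 * w 0%N -> birth 0 * stein_sol 0 = (a 0)%:R - q.
Proof.
move=> h; rewrite /stein_sol A0 F0.
have w1 : w 0%N != 0 by apply: contraTneq h => ->; rewrite mulr0 ltxx.
have b1 : birth 0 != 0 by apply: contraTneq h => ->; rewrite mul0r ltxx.
by field; rewrite b1 w1.
Qed.

(** The increment of the solution is a combination of the increments of the two
  tail-to-flux ratios, which have opposite signs, and of one jump term; taking
  the set empty or full away from the jump gives both bounds. *)
Lemma stein_sol_increment k :
  0 < birth k * w k -> 0 < birth k.+1 * w k.+1 ->
  `|stein_sol k.+1 - stein_sol k| * birth k.+1 <= 1 /\
  `|stein_sol k.+1 - stein_sol k| * death k.+1 <= 1.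
Proof.
move=> h h'.
have wgt : 0 < w k.+1.
  by rewrite lt_neqAle w0 andbT eq_sym; apply: contraTneq h' => ->; rewrite mulr0 ltxx.
have bgt : 0 < birth k.+1 by move: h'; rewrite pmulr_lgt0.
have dgt : 0 < death k.+1 by rewrite mulr_gt0 ?subr_gt0// ltr0n.
have h1 := left_tail_flux k; have h2 := right_tail_flux k.
have := F_le1 k.+1; have := F_ge0 k; have := A_ge0 k; have := A_leF k.
have := A_le k.+1; have := A_tail k.+1.
have -> : stein_sol k.+1 - stein_sol k =
  (death k.+1 * (A k.+1 - q * F k.+1) - birth k.+1 * (A k - q * F k)) /
  (birth k.+1 * death k.+1 * w k.+1).
  by rewrite /stein_sol [birth k * w k]balance; field; rewrite !gt_eqF.
move: h1 h2; rewrite AS FS.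
have : (a k.+1)%:R * w k.+1 = 0 \/ (a k.+1)%:R * w k.+1 = w k.+1.
  by case: (a k.+1); [right; rewrite mul1r | left; rewrite mul0r].
move: ((a k.+1)%:R * w k.+1) => e.
move: (birth k.+1) (death k.+1) (w k.+1) (F k) (A k) bgt dgt wgt => l d x f b.
move=> l0 d0 x0 ex h1 h2 t1 t2 t3 t4 t5 t6.
set N := (X in `|X / _|).
have NE : N = - (b * (l * (1 - f) - d * (1 - (f + x))))
   - (q - (b + e)) * (d * (f + x) - l * f) + e * (d * (1 - (f + x)) + l * f).
  by rewrite /N; ring.
have NE' : N = (f - b) * (l * (1 - f) - d * (1 - (f + x)))
   + (1 - (f + x) - (q - (b + e))) * (d * (f + x) - l * f)
   - (x - e) * (d * (1 - (f + x)) + l * f).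
  by rewrite /N; ring.
have p1 : 0 <= l * (1 - f) - d * (1 - (f + x)) by rewrite subr_ge0.
have p2 : 0 <= d * (f + x) - l * f by rewrite subr_ge0.
have p3 : 0 <= d * (1 - (f + x)) + l * f.
  by rewrite addr_ge0// mulr_ge0// ?(ltW d0) ?(ltW l0)// subr_ge0.
have e0 : 0 <= e <= x by case: ex => ->; rewrite ?lexx ltW.
have up : `|N| <= x * (d * (1 - (f + x)) + l * f).
  case/andP: e0 => e0 ex1; rewrite ler_norml; apply/andP; split.
  - have q1 : 0 <= (f - b) * (l * (1 - f) - d * (1 - (f + x))).
      by rewrite mulr_ge0// subr_ge0.
    have q2 : 0 <= (1 - (f + x) - (q - (b + e))) * (d * (f + x) - l * f).
      by rewrite mulr_ge0// subr_ge0.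
    have q3 : 0 <= e * (d * (1 - (f + x)) + l * f) by rewrite mulr_ge0.
    rewrite -subr_ge0; apply: le_trans (addr_ge0 (addr_ge0 q1 q2) q3) _.
    by rewrite NE' le_eqVlt; apply/orP; left; apply/eqP; ring.
  - have q1 : 0 <= b * (l * (1 - f) - d * (1 - (f + x))) by rewrite mulr_ge0.
    have q2 : 0 <= (q - (b + e)) * (d * (f + x) - l * f).
      by rewrite mulr_ge0// subr_ge0.
    have q3 : 0 <= (x - e) * (d * (1 - (f + x)) + l * f).
      by rewrite mulr_ge0// subr_ge0.
    rewrite -subr_ge0; apply: le_trans (addr_ge0 (addr_ge0 q1 q2) q3) _.
    by rewrite NE le_eqVlt; apply/orP; left; apply/eqP; ring.
have ldx : 0 < l * d * x by rewrite !mulr_gt0.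
rewrite normrM normfV (gtr0_norm ldx).
have bound y : 0 <= y -> x * (d * (1 - (f + x)) + l * f) * y <= l * d * x ->
    `|N| / (l * d * x) * y <= 1.
  move=> y0 hy; rewrite mulrAC ler_pdivrMr// mul1r; apply: le_trans hy.
  by rewrite ler_wpM2r.
have u1 : d * (1 - (f + x)) + l * f <= d.
  by rewrite -subr_ge0; move: p2; congr (_ <= _); ring.
have u2 : d * (1 - (f + x)) + l * f <= l.
  by rewrite -subr_ge0; move: p1; congr (_ <= _); ring.
have ldxE y z : x * y * z = z * y * x by ring.
split; apply: bound; rewrite ?(ltW l0) ?(ltW d0)// ldxE ler_pM2r//.
  by rewrite ler_pM2l.
by rewrite [leRHS]mulrC ler_pM2l.
Qed.

End stein_equation.

(** An inequality replaces the Stein equation of the set with indicator [a] and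
  probability [q]: it allows a constant continuation above the support of a binomial
  law, and it still bounds [q] from above.  The opposite bound comes from the
  complement of the set. *)
Definition stein_bounded {R : realType} (mu theta L : R) (a : nat -> bool) (q : R) :=
  exists2 g : nat -> R,
    (forall k, birth mu theta k * g k.+1 - death theta k * g k <= (a k)%:R - q) &
    (forall k, `|g k.+2 - g k.+1| <= L).

Section stein_solutions.
Context {R : realType}.
Variables (mu theta : R) (w : nat -> R).
Hypothesis theta1 : theta < 1.
Hypothesis mu0 : 0 < mu.
Hypothesis w0 : forall k, 0 <= w k.
Hypothesis balance : forall k,
  birth mu theta k * w k = death theta k.+1 * w k.+1.
Hypothesis F1 : (fun k => \sum_(i < k.+1) w i) @ \oo --> (1 : R).
Variables (a : nat -> bool) (q : R).
Hypothesis A_le : forall k, \sum_(i < k.+1) (a i)%:R * w i <= q.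
Hypothesis A_tail : forall k,
  q - \sum_(i < k.+1) (a i)%:R * w i <= 1 - \sum_(i < k.+1) w i.

Let h := stein_sol mu theta w a q.

(** The case of the Poisson and negative binomial laws, whose birth rates are all
  at least [mu]. *)
Lemma stein_bounded_full : theta <= 0 -> (forall k, 0 < w k) ->
  stein_bounded mu theta mu^-1 a q.
Proof.
move=> theta0 wgt.
have bmu k : mu <= birth mu theta k by rewrite lerDl -mulNr mulr_ge0// oppr_ge0.
have bw k : 0 < birth mu theta k * w k.
  by rewrite mulr_gt0// (lt_le_trans mu0).
exists (fun k => if k is k'.+1 then h k' else 0) => k.
  case: k => [|k]; last by rewrite /h stein_solE.
  by rewrite mulr0 subr0 /h stein_solE0.
have [+ _] := stein_sol_increment theta1 w0 balance F1 A_le A_tail (bw k) (bw k.+1).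
rewrite -ler_pdivlMr ?(lt_le_trans mu0)// div1r => /le_trans; apply.
by rewrite lef_pV2 ?posrE ?(lt_le_trans mu0).
Qed.

(** Binomial laws: the birth rate vanishes at [m].  Above [m] the solution is
  continued by the constant that makes the inequality hold there. *)
Lemma stein_bounded_binomial (m : nat) : 0 < theta -> (0 < m)%N ->
  mu = m%:R * theta -> (forall k, (k <= m)%N -> 0 < w k) ->
  (forall k, (m < k)%N -> w k = 0) ->
  stein_bounded mu theta (mu * (1 - theta))^-1 a q.
Proof.
move=> theta0 m0 muE wgt wz.
have tn : 0 < 1 - theta by rewrite subr_gt0.
have mR : 0 < m%:R :> R by rewrite ltr0n.
have bE k : birth mu theta k = theta * (m%:R - k%:R).
  by rewrite /birth muE; ring.
have bgt k : (k < m)%N -> 0 < birth mu theta k.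
  by move=> km; rewrite bE mulr_gt0// subr_gt0 ltr_nat.
have bw k : (k < m)%N -> 0 < birth mu theta k * w k.
  by move=> km; rewrite mulr_gt0 ?bgt// wgt// ltnW.
pose F k := \sum_(i < k.+1) w i; pose A k := \sum_(i < k.+1) (a i)%:R * w i.
(* the whole mass sits on [0, m] *)
have Fm : F m = 1.
  have cF : (fun k => F (k + m)%N) @ \oo --> (1 : R) by rewrite cvg_shiftn.
  have eF : (fun k => F (k + m)%N) = (fun=> F m).
    apply/funext; elim=> [|k IH]//; rewrite addSn {1}/F big_ord_recr/=.
    by rewrite wz ?addr0// ltnS leq_addl.
  by move: cF; rewrite eF => /cvg_lim <- //; rewrite lim_cst.
have Am : A m = q.
  apply/eqP; rewrite eq_le A_le/= -subr_le0.
  by have := A_tail m; rewrite -/(F m) Fm subrr.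
have q0 : 0 <= q.
  by rewrite (le_trans _ (A_le 0))// big_ord1 mulr_ge0.
have q1 : q <= 1.
  by rewrite -Am -Fm; apply: ler_sum => i _; rewrite ler_piMl//; case: (a i).
pose c := q / (m%:R * (1 - theta)).
pose g k := if k is k'.+1 then (if (k' < m)%N then h k' else c) else 0.
have gm : death theta m * g m = q - (a m)%:R.
  case: m m0 @c @g bw wgt Am Fm muE bE bgt mR wz => // k _ c g bw wgt Am Fm _ _ _ _ _.
  rewrite /g ltnSn /h /stein_sol -/(F k) -/(A k) balance.
  have -> : A k = q - (a k.+1)%:R * w k.+1.
    by rewrite -Am /A [in RHS]big_ord_recr/= addrK.
  have -> : F k = 1 - w k.+1.
    by rewrite -Fm /F [in RHS]big_ord_recr/= addrK.
  field; rewrite (gt_eqF (wgt _ _))//= /death gt_eqF// mulr_gt0// ltr0n//.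
have gmS : g m.+1 = c by rewrite /g ltnn.
have mu1 : mu <= m%:R by rewrite muE ler_piMr// ltW.
have mut : 0 < mu * (1 - theta) by rewrite mulr_gt0.
exists g => [k|k].
  have [km|mk|->] := ltngtP k m.
  - case: k km => [|k] km; first by rewrite /g mulr0 subr0 m0 /h stein_solE0// bw.
    rewrite /g km (ltnW km) /h stein_solE// ?bw// ltnW//.
  - have -> : g k = c by case: k mk => // k; rewrite ltnS /g ltnNge => ->.
    have -> : g k.+1 = c by rewrite /g ltnNge (ltnW mk).
    apply: (@le_trans _ _ (- q)); last by rewrite lerDr.
    rewrite -mulrBl -opprB mulNr lerN2 bE /death.
    have -> : q = (m%:R * (1 - theta)) * c by rewrite /c; field; rewrite !gt_eqF.
    rewrite ler_wpM2r ?divr_ge0 ?mulr_ge0 ?(ltW tn)//.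
    have km : 0 <= k%:R - m%:R :> R by rewrite subr_ge0 ler_nat ltnW.
    rewrite -subr_ge0 (_ : _ - _ = k%:R - m%:R)//; ring.
  - by rewrite gm bE subrr mulr0 mul0r sub0r opprB.
have [km|mk|km] := ltngtP k.+1 m.
- have km' := ltnW km; rewrite /g km km'.
  have [h1 h2] := stein_sol_increment theta1 w0 balance F1 A_le A_tail
    (bw _ km') (bw _ km).
  have [kmu|kmu] := leP k.+1%:R mu.
  + move: h1; rewrite -ler_pdivlMr ?bgt// div1r => /le_trans; apply.
    rewrite lef_pV2 ?posrE ?bgt// bE {1}muE.
    rewrite (_ : _ * _ * _ = theta * (m%:R - mu)); last by rewrite muE; ring.
    by rewrite ler_pM2l// lerB.
  + have d0 : 0 < death theta k.+1 by rewrite mulr_gt0// ltr0n.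
    move: h2; rewrite -ler_pdivlMr// div1r => /le_trans; apply.
    by rewrite lef_pV2 ?posrE// /death mulrC ler_pM2l// ltW.
- rewrite ltnS in mk; rewrite /g !ltnNge mk (leqW mk)/= subrr normr0.
  by rewrite invr_ge0 ltW.
- have dm : 0 < death theta m by rewrite mulr_gt0.
  have ->  : g k.+2 = c by rewrite -gmS -km.
  have -> : g k.+1 = (q - (a m)%:R) / (m%:R * (1 - theta)).
    rewrite km -gm /death; field; rewrite !gt_eqF//.
  rewrite /c -mulrBl opprB addrC subrK normrM normfV.
  rewrite [`|m%:R * _|]gtr0_norm ?mulr_gt0//.
  apply: (@le_trans _ _ (m%:R * (1 - theta))^-1).
    by rewrite ler_piMl ?invr_ge0 ?mulr_ge0 ?(ltW tn)//; case: (a m); rewrite ?normr1 ?normr0.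
  by rewrite lef_pV2 ?posrE ?mulr_gt0// ler_pM2r.
Qed.

End stein_solutions.

(** * The two-state chain as an operator *)

Definition increment {R : realType} (f : nat -> R) (c : nat) : R := f c.+1 - f c.

Section markov_operator.
Context {R : realType}.
Variables alpha beta : R.
Local Notation Q := (transition alpha beta).
Local Notation delta := (beta - alpha).

(** Expectation of [F X_k (c + X_1 + ... + X_k)] for the chain started at
  [X_0 = x]. *)
Fixpoint chain_op (k : nat) (F : bool -> nat -> R) (x : bool) (c : nat) : R :=
  if k is k'.+1 then Q x false * chain_op k' F false c
                     + Q x true * chain_op k' F true c.+1
  else F x c.

Local Notation V := chain_op.

Implicit Types (F G : bool -> nat -> R) (f g : nat -> R) (x y z : bool).

Lemma eq_chain_op k F G x c : (forall y c', F y c' = G y c') ->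
  V k F x c = V k G x c.
Proof. by move=> FG; elim: k x c => [|k IH] x c //=; rewrite !IH. Qed.

Lemma chain_op_lin k (a b : R) F G x c :
  V k (fun y c' => a * F y c' + b * G y c') x c = a * V k F x c + b * V k G x c.
Proof. by elim: k x c => [|k IH] x c //=; rewrite !IH; ring. Qed.

Lemma chain_opB k F G x c :
  V k (fun y c' => F y c' - G y c') x c = V k F x c - V k G x c.
Proof.
rewrite -[V k F x c]mul1r -mulN1r -chain_op_lin.
by apply: eq_chain_op => y c'; ring.
Qed.

Lemma chain_op_shift k F x c : V k (fun y c' => F y c'.+1) x c = V k F x c.+1.
Proof. by elim: k x c => [|k IH] x c //=; rewrite !IH. Qed.

Lemma chain_op_diff k F x c : V k (fun y => increment (F y)) x c = increment (V k F x) c.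
Proof. by rewrite /increment chain_opB (chain_op_shift k F). Qed.

Lemma chain_op_add i j F x c : V (i + j) F x c = V i (fun y => V j F y) x c.
Proof. by elim: i x c => [|i IH] x c //=; rewrite !IH. Qed.

Lemma chain_opSr k F x c : V k.+1 F x c = V k (V 1 F) x c.
Proof. by rewrite -addn1 chain_op_add. Qed.

(** Adding the increments of two independent copies of the chain, started at [x]
  and [y], in either order. *)
Lemma chain_opC i j F x y c :
  V i (fun=> V j F y) x c = V j (fun z => V i (fun=> F z) x) y c.
Proof.
elim: i x c => [|i IH] x c /=; first exact: eq_chain_op.
rewrite !IH (chain_op_lin j (Q x false) (Q x true) (fun z => V i (fun=> F z) false)
  (fun z c' => V i (fun=> F z) true c'.+1)).
by rewrite (chain_op_shift j (fun z => V i (fun=> F z) true)).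
Qed.

Hypothesis a01 : 0 < alpha < 1.
Hypothesis b01 : 0 < beta < 1.

Lemma transition_ge0 x y : 0 <= Q x y.
Proof.
by move: a01 b01 => /andP[? ?] /andP[? ?]; case: x y => [] [] /=; lra.
Qed.

Lemma transition_sum x : Q x false + Q x true = 1.
Proof. by case: x => /=; ring. Qed.

Lemma chain_op_cst k (B : R) x c : V k (fun _ _ => B) x c = B.
Proof.
elim: k x c => [|k IH] x c //=.
by rewrite !IH -mulrDl transition_sum mul1r.
Qed.

Lemma chain_op_le k F G x c : (forall y c', F y c' <= G y c') ->
  V k F x c <= V k G x c.
Proof.
move=> FG; elim: k x c => [|k IH] x c //=.
by apply: lerD; apply: ler_wpM2l; rewrite ?transition_ge0.
Qed.

Lemma chain_op_norm k F (B : R) x c : (forall y c', `|F y c'| <= B) ->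
  `|V k F x c| <= B.
Proof.
move=> FB; rewrite ler_norml -{1}(chain_op_cst k (- B) x c).
rewrite -{2}(chain_op_cst k B x c).
by apply/andP; split; apply: chain_op_le => y c';
  have := FB y c'; rewrite ler_norml => /andP[].
Qed.

(** The influence of the initial state decays geometrically, as powers of the
  second eigenvalue of the transition matrix. *)
Lemma chain_op_init k f c :
  V k (fun=> f) true c - V k (fun=> f) false c =
  \sum_(j < k) delta ^+ j.+1 * V (k - j.+1) (fun=> increment f) true c.
Proof.
elim: k => [|k IH]; first by rewrite big_ord0 /= subrr.
rewrite big_ord_recl subn1 expr1 /= (chain_op_diff k (fun=> f)) /increment.
rewrite (eq_bigr (fun j : 'I_k => delta *
  (delta ^+ j.+1 * V (k - j.+1) (fun=> increment f) true c))).
  by rewrite -mulr_sumr -IH; ring.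
by move=> j _; rewrite /bump /= add1n subSS exprS mulrA.
Qed.

Lemma chain_op_last k f x c :
  V k.+1 (fun=> f) x c - V k (fun=> f) x c =
  V k (fun y c' => Q y true * increment f c') x c.
Proof.
rewrite chain_opSr -chain_opB; apply: eq_chain_op => y c' /=.
have -> : Q y false = 1 - Q y true by rewrite -(transition_sum y) addrK.
by rewrite /increment; ring.
Qed.

Local Notation pi := (stationary_law alpha beta).

Lemma stationary_law_gt0 x : 0 < pi x.
Proof.
move: a01 b01 => /andP[? ?] /andP[? ?].
by case: x; rewrite /stationary_law /p1 divr_gt0//; lra.
Qed.

Lemma stationary_law_sum : pi false + pi true = 1.
Proof.
move: a01 b01 => /andP[? ?] /andP[? ?]; rewrite /= /p1 -mulrDl divff// gt_eqF//; lra.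
Qed.

(** Time reversal of the stationary chain: the path before time [i], seen from
  the state at time [i], is again the chain. *)
Lemma chain_op_reverse i F c :
  pi false * V i F false c + pi true * V i F true c.+1 =
  pi false * V i (fun=> F false) false c + pi true * V i (fun=> F true) true c.+1.
Proof.
elim: i F c => [|i IH] F c //.
rewrite !(chain_opSr i F) IH.
have e y c' : V i (fun=> V 1 F y) y c' =
    Q y false * V i (fun=> F false) y c' + Q y true * V i (fun=> F true) y c'.+1.
  by rewrite chain_opC.
rewrite !e /=.
move: a01 b01 => /andP[? ?] /andP[? ?].
by rewrite /p1; field; rewrite gt_eqF//; lra.
Qed.

(** Expectation of [f S] for the stationary chain [X_0, ..., X_N]. *)
Definition stat_exp (N : nat) (f : nat -> R) : R :=
  pi false * V N (fun=> f) false 0 + pi true * V N (fun=> f) true 1.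

(** Expectation of [f (S - X_i)] given [X_i = x]: past and future are independent
  copies of the chain started at [x]. *)
Definition split_exp (N i : nat) (x : bool) (f : nat -> R) : R :=
  V i (fun=> V (N - i) (fun=> f) x) x 0.

Lemma stat_exp_split N i f : (i <= N)%N ->
  stat_exp N f =
  pi false * split_exp N i false f + pi true * split_exp N i true (f \o S).
Proof.
move=> iN; rewrite /stat_exp -{1 2}(subnKC iN) !chain_op_add chain_op_reverse.
congr (_ + _ * _); rewrite /split_exp -(chain_op_shift i (fun=> V (N - i) (fun=> f) true)).
by apply: eq_chain_op => y c; rewrite -(chain_op_shift (N - i) (fun=> f)).
Qed.

Lemma chain_op_size_bias k g x c :
  V k (fun _ c' => c'%:R * g c') x c = c%:R * V k (fun=> g) x c +
  \sum_(i < k) V i.+1 (fun y c' => if y then V (k - i.+1) (fun=> g) true c' else 0) x c.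
Proof.
elim: k x c => [|k IH] x c; first by rewrite big_ord0 addr0.
rewrite big_ord_recl subn1 [LHS]/= !IH.
have -> : V 1 (fun y c' => if y then V k.+1.-1 (fun=> g) true c' else 0) x c =
    Q x true * V k (fun=> g) true c.+1 by rewrite /= mulr0 add0r.
pose H i y c' := V i.+1
  (fun y c' => if y then V (k - i.+1) (fun=> g) true c' else 0) y c'.
rewrite [X in _ = _ + (_ + X)](_ : _ =
    Q x false * (\sum_(i < k) H i false c) + Q x true * (\sum_(i < k) H i true c.+1)).
  by rewrite -/(H _ _ _) -[c.+1%:R]natr1 [V k.+1 (fun=> g) x c]/=; ring.
rewrite !mulr_sumr -big_split; apply: eq_bigr => i _.
by rewrite /H lift0 subSS.
Qed.

(** Size bias: in [S g(S)] the factor [S] is a sum over the times [i] at which the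
  chain is in state 1, and each time has probability [pi true]. *)
Lemma stat_exp_size_bias N g :
  stat_exp N (fun c => c%:R * g c) =
  pi true * \sum_(i < N.+1) split_exp N i true (g \o S).
Proof.
have e i : split_exp N i true (g \o S) = V i (fun=> V (N - i) (fun=> g) true) true 1.
  rewrite /split_exp -(chain_op_shift i (fun=> V (N - i) (fun=> g) true)).
  by apply: eq_chain_op => y c; rewrite -(chain_op_shift (N - i) (fun=> g)).
under eq_bigr do rewrite e.
rewrite /stat_exp !chain_op_size_bias mul0r add0r mul1r !mulrDr.
rewrite addrCA mulr_sumr [pi true * \sum_(i < N) _]mulr_sumr -big_split/=.
rewrite big_ord_recl subn0 mulrDr; congr (_ + _).
rewrite mulr_sumr; apply: eq_bigr => i _.
pose F y c' := if y then V (N - i.+1) (fun=> g) true c' else 0.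
have := chain_op_reverse i.+1 F 0; rewrite /= => ->.
have z : V i.+1 (fun=> F false) false 0 = 0 by rewrite /F chain_op_cst.
by move: z; rewrite /= => ->; rewrite mulr0 add0r /bump /= add1n.
Qed.

End markov_operator.

(** * Smoothing by the middle states of double steps *)

Section bernoulli_smoothing.
Context {R : realType}.
Variable rho : R.
Implicit Types (h f : nat -> R) (a c : R).

(** Averaging over the addition of a Bernoulli variable. *)
Definition bern h (k : nat) : R := rho * h k.+1 + (1 - rho) * h k.

Let v : R := rho * (1 - rho).

Lemma eq_iter_bern N h h' k : h =1 h' -> iter N bern h k = iter N bern h' k.
Proof. by move=> /funext ->. Qed.

(** Integration by parts for the binomial law: in the Bernoulli average of
  [(j - a) h j], moving [a] to the mean leaves the covariance, which is the
  variance [v] times an increment of [h]. *)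
Lemma iter_bern_by_parts N a h k :
  iter N bern (fun j => (j%:R - a) * h j) k =
  (k%:R + N%:R * rho - a) * iter N bern h k +
  N%:R * v * iter N.-1 bern (increment h) k.
Proof.
elim: N a h k => [|N IH] a h k; first by rewrite /= mul0r addr0 !mul0r addr0.
have -> : iter N.+1 bern (fun j => (j%:R - a) * h j) k =
    iter N bern (fun j => (j%:R - (a - rho)) * bern h j) k +
    v * iter N bern (increment h) k.
  rewrite iterSr.
  have lin M (g1 g2 : nat -> R) (b : R) j :
    iter M bern (fun i => g1 i + b * g2 i) j = iter M bern g1 j + b * iter M bern g2 j.
    by elim: M j => [|M IHM] j //=; rewrite /bern !IHM; ring.
  rewrite -lin; apply: eq_iter_bern => j.
  by rewrite /bern /increment /v -[j.+1%:R]natr1; ring.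
rewrite IH [iter N.+1 bern h]iterSr; case: N IH => [|N] IH.
  by rewrite /=; ring.
have -> : iter N.+1.-1 bern (increment (bern h)) k = iter N.+1 bern (increment h) k.
  rewrite [in RHS]iterSr; apply: eq_iter_bern => j.
  by rewrite /bern /increment; ring.
by rewrite -[N.+2%:R]natr1 /=; ring.
Qed.

Hypothesis rho01 : 0 <= rho <= 1.

Lemma iter_bern_cst N c k : iter N bern (fun=> c) k = c.
Proof. by elim: N k => [|N IH] k //=; rewrite /bern !IH; ring. Qed.

Lemma iter_bern_le N h h' k : (forall j, h j <= h' j) ->
  iter N bern h k <= iter N bern h' k.
Proof.
case/andP: rho01 => r0 r1 hh; elim: N k => [|N IH] k //=.
by apply: lerD; apply: ler_wpM2l; rewrite ?subr_ge0.
Qed.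

Lemma iter_bern_variance N k :
  iter N bern (fun j => (j%:R - (k%:R + N%:R * rho)) ^+ 2) k = N%:R * v.
Proof.
under eq_fun do rewrite expr2.
rewrite iter_bern_by_parts subrr mul0r add0r.
rewrite (@eq_iter_bern _ _ (fun=> 1)) ?iter_bern_cst ?mulr1// => j.
by rewrite /increment -[j.+1%:R]natr1; ring.
Qed.

(** By [iter_bern_by_parts] the left side is, up to the factor [N.+1 * v], the mean
  of the centred variable times [f], of order [sqrt (N.+1 * v)].  The weight [tau]
  of the arithmetic-geometric inequality stays free, so that the bound is affine
  in [N.+1^-1] and can be averaged over a random number of trials. *)
Lemma iter_bern_smooth N (B tau : R) f k : 0 < v -> 0 < tau ->
  (forall j, `|f j| <= B) ->
  `|iter N bern (increment f) k| <= B * ((tau + (tau * v)^-1 * N.+1%:R^-1) / 2).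
Proof.
move=> v0 tau0 fB.
have B0 : 0 <= B by apply: le_trans (fB 0%N).
pose a := k%:R + N.+1%:R * rho.
have ibp : iter N.+1 bern (fun j => (j%:R - a) * f j) k =
    N.+1%:R * v * iter N bern (increment f) k.
  by rewrite iter_bern_by_parts subrr mul0r add0r.
have n0 : 0 < N.+1%:R :> R by rewrite ltr0n.
pose u (j : nat) := B * ((tau * (j%:R - a) ^+ 2 + tau^-1) / 2).
have uE : iter N.+1 bern u k = B * ((tau * (N.+1%:R * v) + tau^-1) / 2).
  rewrite -(iter_bern_variance N.+1 k) -/a.
  have lin M (g1 : nat -> R) (b d : R) j :
    iter M bern (fun i => b * g1 i + d) j = b * iter M bern g1 j + d.
    by elim: M j => [|M IHM] j //=; rewrite /bern !IHM; ring.
  rewrite (@eq_iter_bern _ u (fun j => (B * tau / 2) * (j%:R - a) ^+ 2 + B * tau^-1 / 2)).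
    by rewrite lin; field; rewrite gt_eqF.
  by move=> j; rewrite /u; field; rewrite gt_eqF.
have amgm (y : R) : `|y| <= (tau * y ^+ 2 + tau^-1) / 2.
  rewrite ler_pdivlMr//.
  have -> : tau * y ^+ 2 = tau * `|y| ^+ 2 by rewrite real_normK// num_real.
  rewrite -subr_ge0 (_ : _ - _ = tau * (`|y| - tau^-1) ^+ 2); last first.
    by field; rewrite gt_eqF.
  by rewrite mulr_ge0 ?(ltW tau0)// sqr_ge0.
have le_u j : `|(j%:R - a) * f j| <= u j.
  rewrite normrM mulrC /u; apply: ler_pM => //; exact: amgm.
have : `|iter N.+1 bern (fun j => (j%:R - a) * f j) k| <= iter N.+1 bern u k.
  rewrite ler_norml; apply/andP; split.
    rewrite -[leRHS]opprK lerN2.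
    have oppE M (g : nat -> R) j : - iter M bern g j = iter M bern (fun i => - g i) j.
      by elim: M j => [|M IHM] j //=; rewrite /bern -!IHM; ring.
    rewrite oppE; apply: iter_bern_le => j.
    by rewrite (le_trans _ (le_u j))// ler_normr lexx orbT.
  by apply: iter_bern_le => j; rewrite (le_trans _ (le_u j))// ler_normr lexx.
have nv : 0 < N.+1%:R * v by rewrite mulr_gt0.
rewrite ibp uE normrM (gtr0_norm nv) mulrC -ler_pdivlMr// => /le_trans; apply.
by rewrite le_eqVlt; apply/orP; left; apply/eqP; field; rewrite !gt_eqF//= nat1r.
Qed.

End bernoulli_smoothing.

Section chain_smoothing.
Context {R : realType}.
Variables alpha beta : R.
Hypothesis a01 : 0 < alpha < 1.
Hypothesis b01 : 0 < beta < 1.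
Local Notation Q := (transition alpha beta).
Local Notation V := (chain_op alpha beta).
Local Notation pi := (stationary_law alpha beta).

(** Conditional probability of state 1 at a time whose two neighbours are in
  different states; it is the same for both orders of the neighbours. *)
Definition bridge_prob : R := beta / (beta + (1 - alpha)).

(** Long run frequency, over pairs of steps, of a change from state 0 to
  state 1. *)
Definition switch_rate : R := alpha * (1 - beta) * (beta + (1 - alpha)) / (1 - beta + alpha).

Local Notation rho := bridge_prob.
Local Notation kappa := switch_rate.
Let v : R := rho * (1 - rho).
Let P2 (x : bool) : R := Q x false * Q false (~~ x) + Q x true * Q true (~~ x).

Lemma chain_op_bern k F x c :
  V k (fun y => bern rho (F y)) x c = bern rho (V k F x) c.
Proof.
rewrite /bern (chain_op_lin alpha beta k rho (1 - rho) (fun y c' => F y c'.+1) F).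
by rewrite (chain_op_shift alpha beta k F).
Qed.

Let D0 : 0 < 1 - beta + alpha.
Proof. by move: a01 b01 => /andP[? ?] /andP[? ?]; lra. Qed.

Let E0 : 0 < beta + (1 - alpha).
Proof. by move: a01 b01 => /andP[? ?] /andP[? ?]; lra. Qed.

Lemma bridge_prob01 : 0 < rho < 1.
Proof.
move: a01 b01 => /andP[? ?] /andP[? ?].
by rewrite /rho divr_gt0//= ltr_pdivrMr//; lra.
Qed.

Lemma bridge_prob_var : v = beta * (1 - alpha) / (beta + (1 - alpha)) ^+ 2.
Proof. by rewrite /v /bridge_prob; field; rewrite gt_eqF. Qed.

Lemma switch_rate01 : 0 < kappa <= 2^-1.
Proof.
move: a01 b01 => /andP[? ?] /andP[? ?].
rewrite /kappa divr_gt0 ?mulr_gt0 ?subr_gt0//= ler_pdivrMr//.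
have h1 : alpha * (1 - beta) * (beta + (1 - alpha)) <= alpha * (1 - beta) * (2 - (1 - beta + alpha)).
  by apply: ler_wpM2l; [apply: mulr_ge0|]; lra.
have h2 : alpha * (1 - beta) <= (1 - beta + alpha) ^+ 2 / 4.
  have := sqr_ge0 ((1 - beta - alpha) / 2); rewrite -(subr_ge0 (alpha * _)).
  by congr (_ <= _); field.
have h3 : 0 <= (2 - (1 - beta + alpha)) by lra.
have h4 := ler_wpM2r h3 h2.
have h5 : 0 <= (1 - beta + alpha) * (1 - beta + alpha - 1) ^+ 2.
  by rewrite mulr_ge0 ?sqr_ge0// ltW.
move: (1 - beta + alpha) h1 h4 h5 D0 => d h1 h4 h5 d0.
apply: (le_trans h1); apply: (le_trans h4); lra.
Qed.

(** Conditioning on the states at even times.  When the two ends of a double step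
  differ, its middle state is a Bernoulli variable with parameter [rho]. *)
Lemma chain_op2 k F x c :
  V k.+2 F x c =
  Q x x * Q x x * V k F x (c + x + x)
  + Q x (~~ x) * Q (~~ x) x * V k F x c.+1
  + P2 x * V k (fun y => bern rho (F y)) (~~ x) (c + ~~ x).
Proof.
have h : beta + (1 - alpha) != 0 by rewrite gt_eqF.
rewrite chain_op_bern /P2 /bern /rho; case: x => /=.
- by rewrite !addn1 !addn0; field.
- by rewrite !addn1 !addn0; field.
Qed.

(** Correction that makes the drift of [m + potential x] over a double step, where
  [m] counts the switches so far, the same from both states; see [switch_jump]. *)
Definition potential (x : bool) : R := if x then 3 - pi true else 2 + pi true.

Lemma potential_bounds x : 2 <= potential x <= 3.
Proof.
have := stationary_law_gt0 a01 b01 true; have := stationary_law_gt0 a01 b01 false.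
have := stationary_law_sum a01 b01.
by case: x; rewrite /potential => *; apply/andP; split; lra.
Qed.

Lemma switch_jump x :
  P2 x * (1 + potential (~~ x) - potential x) = 2 * kappa.
Proof.
by case: x; rewrite /P2 /potential /kappa /stationary_law /p1/=; field; rewrite gt_eqF.
Qed.

Lemma switch_prob01 x : 0 <= P2 x <= 1.
Proof.
have q0 y z : 0 <= Q y z := transition_ge0 a01 b01 y z.
have qs := @transition_sum R alpha beta.
have q1 y z : Q y z <= 1.
  rewrite -(qs y); case: z; rewrite ?lerDl ?lerDr//.
rewrite /P2; apply/andP; split; first by rewrite addr_ge0// mulr_ge0.
by rewrite -[leRHS](qs x); apply: lerD; apply: ler_piMr.
Qed.

(** A switch adds at most 2 to [D], which is at least 2; hence the convexity of the
  inverse costs at most half of the drift [2 * kappa]. *)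
Lemma inv_drift x (D : R) : 2 <= D ->
  (1 - P2 x) * D^-1 + P2 x * (D + (1 + potential (~~ x) - potential x))^-1
  <= (D + kappa)^-1.
Proof.
move=> D2; have := switch_jump x; have := potential_bounds x.
have := potential_bounds (~~ x).
set s := 1 + _ - _ => /andP[pa pb] /andP[pc pd] js.
have s0 : 0 <= s by rewrite /s; lra.
have s2 : s <= 2 by rewrite /s; lra.
have /andP[k0 _] := switch_rate01.
have d0 : 0 < D by lra.
have ds : 0 < D + s by lra.
have dk : 0 < D + kappa by lra.
rewrite -subr_ge0 (_ : _ - _ = kappa * (D + 2 * kappa - s) / (D * (D + s) * (D + kappa))).
  apply: divr_ge0; last by rewrite ltW// mulr_gt0// mulr_gt0.
  by apply: mulr_ge0; [exact: ltW|lra].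
have kE : kappa = P2 x * s / 2 by rewrite js; field.
move: ds dk; rewrite kE => ds dk; field; rewrite !gt_eqF//=; lra.
Qed.

Variables (B tau : R) (f : nat -> R) (wt : bool -> R).
Hypothesis tau0 : 0 < tau.
Hypothesis fB : forall j, `|f j| <= B.
Hypothesis wt1 : forall y, `|wt y| <= 1.

Let v0 : 0 < v.
Proof. by have /andP[? ?] := bridge_prob01; rewrite mulr_gt0 ?subr_gt0. Qed.

Let Psi (T : nat) (x : bool) (m : nat) : R :=
  B * ((tau + 3 / (tau * v) * (m%:R + potential x + kappa * T%:R)^-1) / 2).

Let B0 : 0 <= B. Proof. exact: le_trans (fB 0). Qed.

Let PsiS T x m :
  (1 - P2 x) * Psi T x m + P2 x * Psi T (~~ x) m.+1 <= Psi T.+1 x m.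
Proof.
have /andP[k0 _] := switch_rate01; have /andP[px _] := potential_bounds x.
have t0 : 0 <= T%:R :> R by rewrite ler0n.
have m0 : 0 <= m%:R :> R by rewrite ler0n.
pose D := m%:R + potential x + kappa * T%:R.
have kT : 0 <= kappa * T%:R by rewrite mulr_ge0// ltW.
have D2 : 2 <= D by rewrite /D; lra.
have := inv_drift x D2.
rewrite /Psi -/D.
have -> : m%:R + potential x + kappa * T.+1%:R = D + kappa.
  by rewrite /D -natr1; ring.
have -> : m.+1%:R + potential (~~ x) + kappa * T%:R =
    D + (1 + potential (~~ x) - potential x) by rewrite /D -natr1; ring.
have C0 : 0 <= B * (3 / (tau * v)) / 2.
  by rewrite divr_ge0// mulr_ge0// divr_ge0// mulr_ge0 // ltW.
move: (D^-1) ((D + _)^-1) ((D + kappa)^-1) (P2 x) => i1 i2 i3 P.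
move=> h; have := ler_wpM2l C0 h.
move: (3 / (tau * v)) => C hC.
rewrite -subr_ge0 (_ : _ - _ = B * C / 2 * i3 - B * C / 2 * ((1 - P) * i1 + P * i2)).
  by rewrite subr_ge0.
by field.
Qed.

(** By induction on the number of double steps.  Each switch adds one Bernoulli
  average, for [m] averages [iter_bern_smooth] gives a bound affine in
  [m.+1^-1], and [inv_drift] averages such bounds. *)
Lemma chain_op_smooth_aux T x m c :
  `|V T.*2 (fun y c' => wt y * iter m (bern rho) (increment f) c') x c| <= Psi T x m.
Proof.
have /andP[r0 r1] := bridge_prob01.
have rho01 : 0 <= rho <= 1 by rewrite !ltW.
elim: T x m c => [|T IH] x m c.
  have /andP[p2 p3] := potential_bounds x.
  rewrite /= normrM; apply: (@le_trans _ _ (1 * `|iter m (bern rho) (increment f) c|)).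
    by rewrite ler_wpM2r.
  rewrite mul1r; apply: le_trans (iter_bern_smooth rho01 m c v0 tau0 fB) _.
  rewrite -/v; apply: ler_wpM2l => //; rewrite ler_wpM2r ?invr_ge0// lerD2l.
  rewrite [3 / _]mulrC -mulrA ler_wpM2l//.
    by rewrite invr_ge0 ltW// mulr_gt0.
  have m0 : 0 <= m%:R :> R by rewrite ler0n.
  rewrite mulr0 addr0 ler_pdivlMr ?ltr_wpDl//; last lra.
  by rewrite mulrC ler_pdivrMr ?ltr0n// -natr1; lra.
rewrite doubleS chain_op2 -/(P2 x).
have step : V T.*2 (fun y => bern rho (fun c' => wt y * iter m (bern rho) (increment f) c'))
    (~~ x) (c + ~~ x) =
    V T.*2 (fun y c' => wt y * iter m.+1 (bern rho) (increment f) c') (~~ x) (c + ~~ x).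
  by apply: eq_chain_op => y c'; rewrite /= /bern; ring.
rewrite step; apply: le_trans (PsiS T x m).
have q0 y z : 0 <= Q y z := transition_ge0 a01 b01 y z.
have stay z : Q z z * Q z z + Q z (~~ z) * Q (~~ z) z = 1 - P2 z.
  by rewrite /P2; case: z => /=; ring.
apply: le_trans (ler_normD _ _) _; apply: lerD; last first.
  have /andP[P0 _] := switch_prob01 x.
  by rewrite normrM ger0_norm// ler_wpM2l.
apply: le_trans (ler_normD _ _) _; rewrite -stay mulrDl; apply: lerD.
  by rewrite normrM ger0_norm ?mulr_ge0// ler_wpM2l// mulr_ge0.
by rewrite normrM ger0_norm ?mulr_ge0// ler_wpM2l// mulr_ge0.
Qed.

End chain_smoothing.

Section chain_smoothness.
Context {R : realType}.
Variables alpha beta : R.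
Hypothesis a01 : 0 < alpha < 1.
Hypothesis b01 : 0 < beta < 1.
Local Notation V := (chain_op alpha beta).
Local Notation kappa := (switch_rate alpha beta).
Local Notation rho := (bridge_prob alpha beta).

Lemma chain_op_smooth k (B s : R) f wt x c : 0 < s ->
  3 <= s ^+ 2 * (rho * (1 - rho)) * (2 + kappa * (k./2)%:R) ->
  (forall j, `|f j| <= B) -> (forall y, `|wt y| <= 1) ->
  `|V k (fun y c' => wt y * increment f c') x c| <= B * s.
Proof.
move=> s0 hs fB wt1.
have B0 : 0 <= B by apply: le_trans (fB 0%N).
have even_case y c' : `|V (k./2).*2 (fun y c' => wt y * increment f c') y c'| <= B * s.
  have := chain_op_smooth_aux a01 b01 s0 fB wt1 (k./2) y 0 c'.
  move=> /le_trans; apply; apply: ler_wpM2l => //.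
  have /andP[p2 _] := potential_bounds a01 b01 y.
  have /andP[k0 _] := switch_rate01 a01 b01.
  have /andP[r0 r1] := bridge_prob01 a01 b01.
  have v0 : 0 < rho * (1 - rho) by rewrite mulr_gt0 ?subr_gt0.
  have T0 : 0 <= kappa * (k./2)%:R by rewrite mulr_ge0// ltW.
  rewrite ler_pdivrMr// (_ : s * 2 = s + s) ?lerD2l; last by ring.
  rewrite ler_pdivrMr; last by rewrite mulr0n; lra.
  rewrite ler_pdivrMr; last exact: mulr_gt0.
  apply: (le_trans hs).
  have sv : 0 <= s ^+ 2 * (rho * (1 - rho)) by rewrite mulr_ge0 ?sqr_ge0// ltW.
  apply: (@le_trans _ _ (s ^+ 2 * (rho * (1 - rho)) *
    (potential alpha beta y + kappa * (k./2)%:R))).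
    by rewrite ler_wpM2l// lerD2r.
  by rewrite mulr0n add0r le_eqVlt; apply/orP; left; apply/eqP; ring.
rewrite -{1}(odd_double_half k) chain_op_add.
by apply: (chain_op_norm a01 b01) => y c'; exact: even_case.
Qed.

Variable n : nat.
Hypothesis n0 : (0 < n)%N.

(** Order of the effect of a unit shift on the law of the chain sum: the reciprocal
  of the standard deviation collected, on average, by the middle states of double
  steps with different ends.  The factor 5 is the leading coefficient of [C2], as
  [diff_bound] is [2 * smoothness] to first order, against [2 * K1]. *)
Definition smoothness : R := 5 * K1 alpha beta / Num.sqrt n%:R.

Local Notation mn := (Num.min (Num.min (1 - alpha) beta) (1 / 2)).

Let mn0 : 0 < mn.
Proof. by move: a01 b01 => /andP[? ?] /andP[? ?]; rewrite !lt_min; lra. Qed.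

Let cyc : mu1 alpha + mu2 beta + 2 = (1 - beta + alpha) / (alpha * (1 - beta)).
Proof.
move: a01 b01 => /andP[? ?] /andP[? ?]; rewrite /mu1 /mu2; field.
by rewrite !gt_eqF//; lra.
Qed.

Let cyc0 : 0 < mu1 alpha + mu2 beta + 2.
Proof.
rewrite cyc; move: a01 b01 => /andP[? ?] /andP[? ?].
by rewrite divr_gt0 ?mulr_gt0//; lra.
Qed.

Lemma smoothness_gt0 : 0 < smoothness.
Proof.
by rewrite divr_gt0 ?sqrtr_gt0 ?ltr0n// !mulr_gt0 ?sqrtr_gt0// divr_gt0.
Qed.

Lemma smoothness_sqr :
  smoothness ^+ 2 = 125 * ((mu1 alpha + mu2 beta + 2) / mn) / n%:R.
Proof.
rewrite /smoothness expr_div_n sqr_sqrtr ?ler0n// !exprMn !sqr_sqrtr//.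
  by rewrite -natrX mulrA -natrM.
by rewrite divr_ge0 ?(ltW cyc0) ?(ltW mn0).
Qed.

Lemma smoothness_long k : (n <= k.*2 + n %/ 4 + 1)%N ->
  3 <= smoothness ^+ 2 * (rho * (1 - rho)) * (2 + kappa * (k./2)%:R).
Proof.
move=> hk; rewrite smoothness_sqr bridge_prob_var//.
move: (a01) (b01) => /andP[a0 a1] /andP[b0 b1].
have n00 : 0 < n%:R :> R by rewrite ltr0n.
(* at least 3 n / 16 double steps fit, counting one more for the additive 2 *)
have hT : (3 * n <= 16 * (k./2).+1)%N by lia.
have hTR : 3 * n%:R <= 16 * ((k./2)%:R + 1) :> R by rewrite natr1 -!natrM ler_nat.
have /andP[k0 k2] := switch_rate01 a01 b01.
have t0 : 0 <= (k./2)%:R :> R by rewrite ler0n.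
have step1 : kappa * (3 * n%:R / 16) <= 2 + kappa * (k./2)%:R.
  have := ler_wpM2l (ltW k0) hTR; lra.
have e0 : 0 < beta + (1 - alpha) by lra.
have var_min : mn / 2 <= beta * (1 - alpha) / (beta + (1 - alpha)).
  rewrite ler_pdivlMr//.
  have h1 : mn <= beta by rewrite !ge_min lexx orbT.
  have h2 : mn <= 1 - alpha by rewrite !ge_min lexx.
  have := ler_wpM2r (ltW b0) h2.
  have a1' : 0 <= 1 - alpha by lra.
  have := ler_wpM2r a1' h1; lra.
have C0 : 0 <= 125 * ((mu1 alpha + mu2 beta + 2) / mn) / n%:R *
    (beta * (1 - alpha) / (beta + (1 - alpha)) ^+ 2).
  apply: mulr_ge0; last by rewrite divr_ge0 ?sqr_ge0// mulr_ge0; lra.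
  by rewrite divr_ge0 ?(ltW n00)// mulr_ge0// divr_ge0 ?(ltW cyc0) ?(ltW mn0).
apply: le_trans (ler_wpM2l C0 step1).
rewrite cyc /kappa; set M := mn in var_min *.
have M0 : 0 < M by exact: mn0.
have half : 2^-1 <= beta * (1 - alpha) / (beta + (1 - alpha)) / M.
  by rewrite ler_pdivlMr// mulrC.
apply: (@le_trans _ _ (375 / 16 * (beta * (1 - alpha) / (beta + (1 - alpha)) / M))).
  by move: (_ / M) half => X hX; lra.
rewrite le_eqVlt; apply/orP; left; apply/eqP.
by field; rewrite !gt_eqF//=; lra.
Qed.

(** The longer of the two independent pieces of the chain does the smoothing. *)
Lemma chain_op_smooth2 l r (B : R) f wt x y c :
  (n <= l + r + n %/ 4 + 1)%N ->
  (forall j, `|f j| <= B) -> (forall z, `|wt z| <= 1) ->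
  `|V l (fun z c' => wt z * V r (fun=> increment f) y c') x c| <= B * smoothness.
Proof.
move=> hn fB wt1; have s0 := smoothness_gt0.
have [rl|lr] := leqP r l.
  have dV z c' : wt z * V r (fun=> increment f) y c' = wt z * increment (V r (fun=> f) y) c'.
    by rewrite (chain_op_diff alpha beta r (fun=> f)).
  rewrite (eq_chain_op alpha beta l x c dV).
  apply: chain_op_smooth => //.
    by apply: smoothness_long; lia.
  by move=> j; exact: chain_op_norm.
apply: chain_op_norm => // z c'.
rewrite normrM -[leRHS]mul1r; apply: ler_pM => //.
have := @chain_op_smooth r B smoothness f (fun=> 1) y c' s0.
rewrite (eq_chain_op alpha beta r y c' (G := fun=> increment f)); last first.
  by move=> *; rewrite mul1r.
apply=> //; last by move=> _; rewrite normr1.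
by apply: smoothness_long; lia.
Qed.

End chain_smoothness.

(** * Conditional laws given one state *)

Section geometric_weights.
Context {R : realType}.
Implicit Types (d : R) (l J : nat).

Lemma geo_sum d l : 0 <= d < 1 -> \sum_(j < l) d ^+ j.+1 <= d / (1 - d).
Proof.
move=> /andP[d0 d1]; have e0 : 0 < 1 - d by rewrite subr_gt0.
rewrite ler_pdivlMr//; suff -> : (\sum_(j < l) d ^+ j.+1) * (1 - d) = d - d ^+ l.+1.
  by rewrite gerBl exprn_ge0.
elim: l => [|l IH]; first by rewrite big_ord0 mul0r expr1 subrr.
by rewrite big_ord_recr/= mulrDl IH [d ^+ l.+2]exprS; ring.
Qed.

Lemma geo_sum_weighted d l : 0 <= d < 1 ->
  \sum_(j < l) d ^+ j.+1 * j.+1%:R <= d / (1 - d) ^+ 2.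
Proof.
move=> /andP[d0 d1]; have e0 : 0 < (1 - d) ^+ 2 by rewrite exprn_gt0// subr_gt0.
rewrite ler_pdivlMr//.
suff -> : (\sum_(j < l) d ^+ j.+1 * j.+1%:R) * (1 - d) ^+ 2 =
    d - d ^+ l.+1 * (1 + l%:R * (1 - d)).
  by rewrite gerBl mulr_ge0 ?exprn_ge0// addr_ge0// mulr_ge0// subr_ge0 ltW.
elim: l => [|l IH]; first by rewrite big_ord0 mul0r expr1 mul0r addr0 mulr1 subrr.
by rewrite big_ord_recr/= mulrDl IH -natr1 [d ^+ l.+2]exprS; ring.
Qed.

Lemma geo_sum_tail d l J : 0 <= d < 1 ->
  \sum_(j < l) d ^+ j.+1 * (J <= j)%:R <= d ^+ J.+1 / (1 - d).
Proof.
move=> /andP[d0 d1]; have e0 : 0 < 1 - d by rewrite subr_gt0.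
rewrite ler_pdivlMr//.
suff -> : (\sum_(j < l) d ^+ j.+1 * (J <= j)%:R) * (1 - d) =
    d ^+ J.+1 - d ^+ (maxn J l).+1 by rewrite gerBl exprn_ge0.
elim: l => [|l IH]; first by rewrite big_ord0 mul0r maxn0 subrr.
rewrite big_ord_recr/= mulrDl IH; case: leqP => Jl /=.
  rewrite (maxn_idPr (leqW Jl)) [d ^+ l.+2]exprS; ring.
by rewrite (maxn_idPl Jl); ring.
Qed.

(** Geometric weights beat a bound of linear growth that is only available up to
  rank [J], beyond which a constant bound is used. *)
Lemma geo_sum_split (delta a c b : R) J l (x : nat -> R) :
  `|delta| < 1 -> 0 <= a -> 0 <= c -> 0 <= b ->
  (forall j, (j < l)%N -> `|x j| <= b) ->
  (forall j, (j < l)%N -> (j < J)%N -> `|x j| <= j.+1%:R * a + c) ->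
  `|\sum_(j < l) delta ^+ j.+1 * x j| <=
  a * (`|delta| / (1 - `|delta|) ^+ 2) + c * (`|delta| / (1 - `|delta|))
  + b * (`|delta| ^+ J.+1 / (1 - `|delta|)).
Proof.
move=> d1 a0 c0 b0 xb xJ; have d01 : 0 <= `|delta| < 1 by rewrite normr_ge0.
apply: (@le_trans _ _ (a * (\sum_(j < l) `|delta| ^+ j.+1 * j.+1%:R) +
    c * (\sum_(j < l) `|delta| ^+ j.+1) +
    b * (\sum_(j < l) `|delta| ^+ j.+1 * (J <= j)%:R))); last first.
  apply: lerD; last by rewrite ler_wpM2l// geo_sum_tail.
  by apply: lerD; rewrite ler_wpM2l ?geo_sum_weighted ?geo_sum.
rewrite !mulr_sumr -!big_split; apply: le_trans (ler_norm_sum _ _ _) _.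
apply: ler_sum => j _; rewrite normrM normrX /=.
have dj : 0 <= `|delta| ^+ j.+1 by rewrite exprn_ge0.
rewrite (_ : _ + _ = `|delta| ^+ j.+1 * (j.+1%:R * a + c + b * (J <= j)%:R)); last by ring.
rewrite ler_wpM2l//; case: leqP => Jj /=.
  by rewrite mulr1 (le_trans (xb j _))// lerDr addr_ge0// mulr_ge0.
by rewrite mulr0 addr0 xJ.
Qed.

End geometric_weights.

Lemma past_length N i j : (i <= N)%N -> (j < i)%N -> (j < N.+1 %/ 4)%N ->
  (N.+1 <= i - j.+1 + (N - i) + N.+1 %/ 4 + 1)%N.
Proof. lia. Qed.

Lemma future_length N i j : (i <= N)%N -> (j < N - i)%N -> (j < N.+1 %/ 4)%N ->
  (N.+1 <= i + (N - i - j.+1) + N.+1 %/ 4 + 1)%N.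
Proof. lia. Qed.

Section conditional_laws.
Context {R : realType}.
Variables alpha beta : R.
Hypothesis a01 : 0 < alpha < 1.
Hypothesis b01 : 0 < beta < 1.
Variable N : nat.
Local Notation n := N.+1.
Local Notation J := (n %/ 4)%N.
Local Notation V := (chain_op alpha beta).
Local Notation pi := (stationary_law alpha beta).
Local Notation delta := (beta - alpha).
Local Notation d := `|delta|.
Local Notation s := (smoothness alpha beta n).
Local Notation E := (split_exp alpha beta N).
Implicit Types (f g h : nat -> R) (B : R) (i j : nat).

Lemma delta_lt1 : d < 1.
Proof.
by move: a01 b01 => /andP[? ?] /andP[? ?]; rewrite ltr_norml; apply/andP; split; lra.
Qed.

Let e0 : 0 < 1 - d. Proof. by rewrite subr_gt0 delta_lt1. Qed.
Let s0 : 0 < s. Proof. exact: smoothness_gt0. Qed.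
Let s0' : 0 <= s. Proof. exact: ltW. Qed.
Let dd0 : 0 <= d / (1 - d). Proof. by rewrite divr_ge0// ltW. Qed.
Let dJ0 : 0 <= d ^+ J.+1 / (1 - d).
Proof. by rewrite divr_ge0 ?exprn_ge0// ltW. Qed.

(** The effect of the state at time [i] dies out after [j.+1] further steps of the
  past, respectively of the future, leaving that many fewer terms in the sum. *)
Definition past_term i j f : R :=
  V (i - j.+1) (fun=> V (N - i) (fun=> f) true) true 0.
Definition future_term i j f : R :=
  V i (fun=> V (N - i - j.+1) (fun=> f) true) false 0.

Lemma split_exp_diff i g :
  E i true g - E i false g =
  \sum_(j < i) delta ^+ j.+1 * past_term i j (increment g) +
  \sum_(j < N - i) delta ^+ j.+1 * future_term i j (increment g).
Proof.
rewrite /split_exp -[LHS](subrKA (V i (fun=> V (N - i) (fun=> g) true) false 0)).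
congr (_ + _).
  rewrite chain_op_init; apply: eq_bigr => j _; congr (_ * _).
  by apply: eq_chain_op => y c; rewrite (chain_op_diff alpha beta (N - i) (fun=> g)).
rewrite -chain_opB.
have e (y : bool) c : V (N - i) (fun=> g) true c - V (N - i) (fun=> g) false c =
  \sum_(j < N - i) delta ^+ j.+1 * V (N - i - j.+1) (fun=> increment g) true c.
  exact: chain_op_init.
have sumE m (F : 'I_m -> bool -> nat -> R) x c :
    V i (fun y c' => \sum_(j < m) F j y c') x c = \sum_(j < m) V i (F j) x c.
  elim: (i) x c => [|k IH] x c //=.
  by rewrite !IH !mulr_sumr -big_split.
rewrite (eq_chain_op alpha beta i false 0 e).
rewrite (sumE _ (fun (j : 'I_(N - i)) _ c => delta ^+ j.+1 * V (N - i - j.+1) (fun=> increment g) true c)).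
apply: eq_bigr => j _.
rewrite /future_term -[RHS]addr0.
rewrite -(mul0r (V i (fun=> fun=> 0) false 0)) -chain_op_lin.
by apply: eq_chain_op => y c; rewrite mul0r addr0.
Qed.

Let diffB f B : (forall j, `|f j| <= B) -> forall j, `|increment f j| <= 2 * B.
Proof.
move=> fB j; apply: le_trans (ler_normB _ _) _.
have := fB j; have := fB j.+1; lra.
Qed.

Let V2 k l f B x y c : (forall j, `|f j| <= B) ->
  `|V k (fun=> V l (fun=> f) y) x c| <= B.
Proof. by move=> fB; do 2 apply: chain_op_norm => // ? ?. Qed.

Let V2s k l f B x y c : (n <= k + l + J + 1)%N -> (forall j, `|f j| <= B) ->
  `|V k (fun=> V l (fun=> increment f) y) x c| <= B * s.
Proof.
move=> hn fB.
have := @chain_op_smooth2 _ _ _ a01 b01 n isT k l B f (fun=> 1) x y c hn fB.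
rewrite (eq_chain_op alpha beta k x c (G := fun=> V l (fun=> increment f) y)).
  by apply=> z; rewrite normr1.
by move=> z c'; rewrite mul1r.
Qed.

Definition near_bound : R :=
  pi true * s + 2 * s * (d / (1 - d)) + 4 * (d ^+ J.+1 / (1 - d)).

Lemma near_bound_ge0 : 0 <= near_bound.
Proof.
have p0 := ltW (stationary_law_gt0 a01 b01 true).
apply: addr_ge0; last exact: mulr_ge0.
by apply: addr_ge0; apply: mulr_ge0 => //; exact: mulr_ge0.
Qed.

(** The laws of [S] and of [S - X_i] given [X_i = 1] differ by the shift by [X_i]
  and by the effect of the state at time [i]; both are small shifts of a smooth
  law. *)
Lemma split_exp_near i f B : (i <= N)%N -> (forall j, `|f j| <= B) ->
  `|E i true f - stat_exp alpha beta N f| <= B * near_bound.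
Proof.
move=> iN fB; have B0 : 0 <= B by apply: le_trans (fB 0%N).
have piS := stationary_law_sum a01 b01.
have p0 := stationary_law_gt0 a01 b01 false.
have p1 := stationary_law_gt0 a01 b01 true.
rewrite (stat_exp_split a01 b01 _ iN).
have -> : E i true (f \o S) = E i true f + E i true (increment f).
  rewrite -[LHS](subrKC (E i true f)); congr (_ + _).
  rewrite /split_exp -chain_opB; apply: eq_chain_op => y c.
  by rewrite -chain_opB; apply: eq_chain_op.
have -> : E i true f - (pi false * E i false f + pi true * (E i true f + E i true (increment f))) =
    pi false * (E i true f - E i false f) - pi true * E i true (increment f).
  have -> : pi true = 1 - pi false by rewrite -piS addrC addKr.
  by ring.
apply: le_trans (ler_normB _ _) _.
rewrite normrM [`|pi true * _|]normrM (gtr0_norm p0) (gtr0_norm p1).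
have h1 : `|E i true (increment f)| <= B * s.
  by apply: V2s => //; rewrite subnKC// addnAC addn1 leq_addr.

have h2 : `|E i true f - E i false f| <=
    2 * (B * s * (d / (1 - d)) + 2 * B * (d ^+ J.+1 / (1 - d))).
  rewrite split_exp_diff; apply: le_trans (ler_normD _ _) _.
  have Bs0 : 0 <= B * s by rewrite mulr_ge0// ltW.
  have B20 : 0 <= 2 * B by rewrite mulr_ge0.
  rewrite [leRHS](_ : _ = (0 * (d / (1 - d) ^+ 2) + B * s * (d / (1 - d))
    + 2 * B * (d ^+ J.+1 / (1 - d))) + (0 * (d / (1 - d) ^+ 2) + B * s * (d / (1 - d))
    + 2 * B * (d ^+ J.+1 / (1 - d)))); last by ring.
  apply: lerD.
  - apply: (geo_sum_split (x := fun j => past_term i j (increment f))) => //.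
    + exact: delta_lt1.
    + by move=> j jl; apply: V2; exact: diffB.
    + by move=> j jl jJ; rewrite mulr0 add0r; apply: V2s => //; exact: past_length.
  - apply: (geo_sum_split (x := fun j => future_term i j (increment f))) => //.
    + exact: delta_lt1.
    + by move=> j jl; apply: V2; exact: diffB.
    + by move=> j jl jJ; rewrite mulr0 add0r; apply: V2s => //; exact: future_length.
rewrite addrC; have h3 := ler_wpM2l (ltW p1) h1.
set w := 2 * _ in h2; have w0 : 0 <= w.
  by apply: mulr_ge0 => //; apply: addr_ge0; apply: mulr_ge0 => //; exact: mulr_ge0.
apply: (@le_trans _ _ (pi true * (B * s) + w)).
  apply: lerD => //; apply: le_trans (ler_wpM2l (ltW p0) h2) _.
  by rewrite ler_piMl// -piS lerDl ltW.
by rewrite /near_bound /w le_eqVlt; apply/orP; left; apply/eqP; ring.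
Qed.

(** Each of the [j] removed steps shifts the chain sum by at most one, and its state
  enters the remaining expectation as a weight at most 1. *)
Lemma chain_op_truncate l r j f B y c : (j <= l)%N -> (n <= l - j + r + J + 1)%N ->
  (forall j, `|f j| <= B) ->
  `|V (l - j) (fun=> V r (fun=> f) y) true c - V l (fun=> V r (fun=> f) y) true c|
  <= j%:R * (B * s).
Proof.
move=> jl hn fB; elim: j jl hn => [|j IH] jl hn.
  by rewrite subn0 subrr normr0 mul0r.
have hj : `|V (l - j) (fun=> V r (fun=> f) y) true c
          - V (l - j.+1) (fun=> V r (fun=> f) y) true c| <= B * s.
  rewrite -(subnSK jl).
  rewrite chain_op_last.
  have q01 z : `|transition alpha beta z true| <= 1.
    rewrite ger0_norm ?transition_ge0//.
    by rewrite -(transition_sum alpha beta z) lerDr transition_ge0.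
  have dV z c' : transition alpha beta z true * increment (V r (fun=> f) y) c' =
     transition alpha beta z true * V r (fun=> increment f) y c'.
    by rewrite (chain_op_diff alpha beta r (fun=> f)).
  by rewrite (eq_chain_op alpha beta _ true c dV); apply: chain_op_smooth2.
have hn' : (n <= l - j + r + J + 1)%N.
  by apply: leq_trans hn _; rewrite !leq_add2r leq_sub2l.
have IHj := IH (ltnW jl) hn'.
rewrite -natr1 mulrDl mul1r [leRHS]addrC.
apply: le_trans (ler_distD (V (l - j) (fun=> V r (fun=> f) y) true c) _ _) _.
by apply: lerD => //; rewrite distrC.
Qed.

Definition diff_bound : R :=
  2 * s * (d / (1 - d) ^+ 2) + 2 * near_bound * (d / (1 - d))
  + (s * (d / (1 - d)) + 2 * (d ^+ J.+1 / (1 - d))) * (d / (1 - d))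
  + 4 * (d ^+ J.+1 / (1 - d)).

Lemma diff_bound_ge0 : 0 <= diff_bound.
Proof.
have nn := near_bound_ge0.
have dd2 : 0 <= d / (1 - d) ^+ 2 by rewrite divr_ge0// sqr_ge0.
apply: addr_ge0; last exact: mulr_ge0.
apply: addr_ge0; first by apply: addr_ge0; apply: mulr_ge0 => //; exact: mulr_ge0.
by apply: mulr_ge0 => //; apply: addr_ge0; exact: mulr_ge0.
Qed.

(** Mean effect of the state at time [i] on the sum of the other states. *)
Definition init_weight i : R :=
  \sum_(j < i) delta ^+ j.+1 + \sum_(j < N - i) delta ^+ j.+1.

(** First order expansion of the effect of the state at time [i]: all increments
  are compared with the same mean increment. *)
Lemma split_exp_diff_near i g B : (i <= N)%N -> (forall j, `|increment g j| <= B) ->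
  `|E i true g - E i false g - init_weight i * stat_exp alpha beta N (increment g)|
  <= B * diff_bound.
Proof.
move=> iN; set f := increment g => fB; have B0 : 0 <= B by apply: le_trans (fB 0%N).
set M := stat_exp _ _ _ _.
have near := split_exp_near iN fB; rewrite -/M in near.
have M1 : `|M| <= B.
  have piS := stationary_law_sum a01 b01.
  have p0 := stationary_law_gt0 a01 b01 false.
  have p1 := stationary_law_gt0 a01 b01 true.
  rewrite /M /stat_exp -[leRHS]mul1r -piS mulrDl.
  apply: le_trans (ler_normD _ _) _.
  rewrite normrM [`|pi true * _|]normrM (gtr0_norm p0) (gtr0_norm p1).
  by apply: lerD; rewrite ler_pM2l//; apply: chain_op_norm.
have le2B (x : R) : `|x| <= B -> `|x - M| <= 2 * B.
  move=> xB; apply: le_trans (ler_normB _ _) _; lra.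
rewrite split_exp_diff /init_weight mulrDl opprD addrACA.
rewrite !mulr_suml -!sumrB.
under eq_bigr do rewrite -mulrBr.
under [X in _ + X]eq_bigr do rewrite -mulrBr.
have Bs0 : 0 <= B * s by rewrite mulr_ge0// ltW.
have B20 : 0 <= 2 * B by rewrite mulr_ge0.
have Bn0 : 0 <= B * near_bound by rewrite mulr_ge0 ?near_bound_ge0.
pose c2 := B * s * (d / (1 - d)) + 2 * B * (d ^+ J.+1 / (1 - d)).
have c20 : 0 <= c2.
  by apply: addr_ge0; apply: mulr_ge0.
have init : `|E i true f - V i (fun=> V (N - i) (fun=> f) true) false 0| <= c2.
  rewrite /split_exp chain_op_init.
  rewrite [leRHS](_ : _ = (0 * (d / (1 - d) ^+ 2) + B * s * (d / (1 - d))
    + 2 * B * (d ^+ J.+1 / (1 - d)))); last by rewrite /c2; ring.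
  have dV j c : V (i - j.+1) (fun=> increment (V (N - i) (fun=> f) true)) true c =
     V (i - j.+1) (fun=> V (N - i) (fun=> increment f) true) true c.
    by apply: eq_chain_op => y c'; rewrite (chain_op_diff alpha beta (N - i) (fun=> f)).
  apply: (geo_sum_split (x := fun j =>
    V (i - j.+1) (fun=> increment (V (N - i) (fun=> f) true)) true 0)) => //.
  - exact: delta_lt1.
  - by move=> j jl; rewrite dV; apply: V2; exact: diffB.
  - by move=> j jl jJ; rewrite dV mulr0 add0r; apply: V2s => //; exact: past_length.
apply: le_trans (ler_normD _ _) _.
rewrite [leRHS](_ : _ = (B * s * (d / (1 - d) ^+ 2) + B * near_bound * (d / (1 - d))
   + 2 * B * (d ^+ J.+1 / (1 - d))) +
   (B * s * (d / (1 - d) ^+ 2) + (c2 + B * near_bound) * (d / (1 - d))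
   + 2 * B * (d ^+ J.+1 / (1 - d)))); last by rewrite /diff_bound /c2; ring.
apply: lerD.
- apply: (geo_sum_split (x := fun j => past_term i j f - M)) => //.
  + exact: delta_lt1.
  + by move=> j jl; apply: le2B; exact: V2.
  + move=> j jl jJ; apply: le_trans (ler_distD (E i true f) _ _) _.
    by apply: lerD => //; apply: chain_op_truncate => //; exact: past_length.
- apply: (geo_sum_split (x := fun j => future_term i j f - M)) => //.
  + exact: delta_lt1.
  + by rewrite addr_ge0.
  + by move=> j jl; apply: le2B; exact: V2.
  + move=> j jl jJ; apply: le_trans (ler_distD (E i true f) _ _) _.
    rewrite addrA; apply: lerD => //.
    apply: le_trans (ler_distD (V i (fun=> V (N - i) (fun=> f) true) false 0) _ _) _.
    apply: lerD; last by rewrite distrC.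
    rewrite /future_term !(chain_opC alpha beta i).
    (* the roles of past and future are exchanged, so that the steps removed
       are those of the chain started at the state 1 *)
    apply: chain_op_truncate => //.
    by rewrite [(_ - _ + i)%N]addnC; exact: future_length.
Qed.

End conditional_laws.

(** * The Stein error of the chain sum *)

Section stein_error.
Context {R : realType}.
Variables alpha beta : R.
Hypothesis a01 : 0 < alpha < 1.
Hypothesis b01 : 0 < beta < 1.
Variable N : nat.
Local Notation n := N.+1.
Local Notation J := (n %/ 4)%N.
Local Notation p := (p1 alpha beta).
Local Notation delta := (beta - alpha).
Local Notation d := `|delta|.
Local Notation s := (smoothness alpha beta n).
Local Notation E := (split_exp alpha beta N).
Local Notation ES := (stat_exp alpha beta N).
Local Notation t := (Num.max alpha beta).
Implicit Types (f g : nat -> R).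

Lemma eq_stat_exp f g : f =1 g -> ES f = ES g.
Proof. by move=> /funext ->. Qed.

Lemma eq_split_exp i x f g : f =1 g -> E i x f = E i x g.
Proof. by move=> /funext ->. Qed.

Lemma stat_exp_lin (a b : R) f g :
  ES (fun k => a * f k + b * g k) = a * ES f + b * ES g.
Proof. by rewrite /stat_exp !chain_op_lin; ring. Qed.

Lemma split_exp_lin i x (a b : R) f g :
  E i x (fun k => a * f k + b * g k) = a * E i x f + b * E i x g.
Proof.
rewrite /split_exp -chain_op_lin; apply: eq_chain_op => y c.
by rewrite -chain_op_lin.
Qed.

Lemma stat_exp_cst (c : R) : ES (fun=> c) = c.
Proof.
by rewrite /stat_exp !(chain_op_cst alpha beta) -mulrDl stationary_law_sum ?mul1r.
Qed.

Lemma split_exp_cst i x (c : R) : E i x (fun=> c) = c.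
Proof.
rewrite /split_exp -[RHS](chain_op_cst alpha beta i c x 0).
by apply: eq_chain_op => y c'; rewrite (chain_op_cst alpha beta).
Qed.

Lemma stat_exp_le f g : (forall k, f k <= g k) -> ES f <= ES g.
Proof.
move=> fg; rewrite /stat_exp; apply: lerD; apply: ler_wpM2l;
  by [exact/ltW/stationary_law_gt0 | apply: chain_op_le].
Qed.

Lemma p1_gt0 : 0 < p. Proof. exact: (stationary_law_gt0 a01 b01 true). Qed.

Lemma stationary_false : stationary_law alpha beta false = 1 - p.
Proof. by rewrite -(stationary_law_sum a01 b01) addrK. Qed.

Lemma p1_lt1 : p < 1.
Proof. by rewrite -subr_gt0 -stationary_false stationary_law_gt0. Qed.

Lemma stat_exp_mean : ES (fun k => k%:R) = n%:R * p.
Proof.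
rewrite (eq_stat_exp (g := fun k => k%:R * (fun=> 1) k)) => [|k]; last by rewrite mulr1.
rewrite (stat_exp_size_bias a01 b01).
rewrite (eq_bigr (fun=> 1)) => [|i _]; last exact: split_exp_cst.
by rewrite sumr_const card_ord mulrC.
Qed.

Definition stein_exp (mu theta : R) g : R :=
  ES (fun k => birth mu theta k * g k.+1 - death theta k * g k).

(** Size bias turns [k * (theta * g k.+1 + (1 - theta) * g k)] into a sum over the
  times [i] with [X_i = 1], and conditioning on [X_i] does the same for the part
  with the factor [mu]; what is left are increments of [g]. *)
Lemma stein_expE theta g : let G := g \o S in
  stein_exp (n%:R * p) theta g =
  p * \sum_(i < n) ((p - theta) * E i true (increment G)
                    - (1 - p) * (E i true G - E i false G)).
Proof.
move=> G; pose h k := theta * g k.+1 + (1 - theta) * g k.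
have -> : stein_exp (n%:R * p) theta g =
    n%:R * p * ES G - ES (fun k => k%:R * h k).
  rewrite -[RHS]mul1r mulrBr mulrA -mulNr mul1r -stat_exp_lin; apply: eq_stat_exp => k.
  by rewrite /birth /death /G /h /=; ring.
rewrite (stat_exp_size_bias a01 b01).
have -> : n%:R * p * ES G = p * \sum_(i < n) (p * (E i true G + E i true (increment G))
    + (1 - p) * E i false G).
  rewrite (eq_bigr (fun=> ES G)); last first.
    move=> i _; rewrite (stat_exp_split a01 b01 G (ltn_ord i : (i <= N)%N)).
    rewrite stationary_false [LHS]addrC; congr (_ * _ + _).
    rewrite -[E i true G]mul1r -[E i true (increment G)]mul1r -split_exp_lin.
    by congr (_ * _); apply: eq_split_exp => k /=; rewrite /increment; ring.
  by rewrite sumr_const card_ord -mulr_natl; ring.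
rewrite -mulrBr -sumrB; congr (_ * _); apply: eq_bigr => i _.
have -> : E i true (h \o S) = E i true G + theta * E i true (increment G).
  rewrite -[E i true G]mul1r -split_exp_lin.
  by apply: eq_split_exp => k /=; rewrite /h /G /increment /=; ring.
by rewrite /=; ring.
Qed.

Lemma split_exp_id_diff i :
  E i true (fun k => k.+1%:R) - E i false (fun k => k.+1%:R) =
  init_weight alpha beta N i.
Proof.
rewrite split_exp_diff /init_weight.
have dE : increment (fun k : nat => k.+1%:R) = (fun=> 1 : R).
  by apply/funext => k; rewrite /increment -[k.+2%:R]natr1; ring.
rewrite dE; congr (_ + _); apply: eq_bigr => j _; rewrite /past_term /future_term.
  rewrite (eq_chain_op alpha beta _ _ _ (G := fun _ _ => 1)) ?(chain_op_cst alpha beta) ?mulr1//.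
  by move=> y c; rewrite (chain_op_cst alpha beta).
rewrite (eq_chain_op alpha beta _ _ _ (G := fun _ _ => 1)) ?(chain_op_cst alpha beta) ?mulr1//.
by move=> y c; rewrite (chain_op_cst alpha beta).
Qed.

(** Sum of the coefficients of the mean increment in [stein_expE].  It is the value
  of the Stein error at the identity, hence the mismatch of the variances. *)
Definition first_order (theta : R) : R :=
  p * \sum_(i < n) ((p - theta) - (1 - p) * init_weight alpha beta N i).

Lemma first_orderE theta :
  first_order theta = n%:R * p * (1 - theta)
    - (ES (fun k => k%:R ^+ 2) - (n%:R * p) ^+ 2).
Proof.
have -> : first_order theta = stein_exp (n%:R * p) theta (fun k => k%:R).
  rewrite stein_expE /first_order; congr (_ * _); apply: eq_bigr => i _.
  rewrite split_exp_id_diff.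
  have -> : increment ((fun k => k%:R) \o S) = (fun=> 1 : R).
    by apply/funext => k; rewrite /increment /= -[k.+2%:R]natr1; ring.
  by rewrite split_exp_cst mulr1.
rewrite /stein_exp.
rewrite (eq_stat_exp (g := fun k => (n%:R * p - theta) * k%:R +
    1 * (- 1 * k%:R ^+ 2 + (n%:R * p) * 1))).
  rewrite (stat_exp_lin (n%:R * p - theta) 1 (fun k => k%:R)).
  rewrite (stat_exp_lin (-1) (n%:R * p) (fun k => k%:R ^+ 2) (fun=> 1)).
  by rewrite stat_exp_mean stat_exp_cst; ring.
by move=> k; rewrite /birth /death -natr1; ring.
Qed.

(** Subtracting from every increment the same mean [M] leaves the errors of
  [split_exp_near] and [split_exp_diff_near], and collects the first order terms
  in one coefficient. *)
Lemma stein_exp_bound theta g (L : R) : (forall k, `|g k.+2 - g k.+1| <= L) ->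
  `|stein_exp (n%:R * p) theta g| <=
  L * (n%:R * p * (`|p - theta| * near_bound alpha beta N
                   + (1 - p) * diff_bound alpha beta N) + `|first_order theta|).
Proof.
move=> gL; rewrite stein_expE; set G := g \o S.
have p0 := p1_gt0; have q0 : 0 < 1 - p by rewrite subr_gt0 p1_lt1.
have GL j : `|increment G j| <= L by exact: gL.
set M := ES (increment G).
have ML : `|M| <= L.
  rewrite /M /stat_exp -[leRHS]mul1r -(stationary_law_sum a01 b01) mulrDl.
  apply: le_trans (ler_normD _ _) _; 
  rewrite normrM [`|stationary_law _ _ true * _|]normrM.
  rewrite !(gtr0_norm (stationary_law_gt0 a01 b01 _)).
  by apply: lerD; rewrite ler_pM2l ?stationary_law_gt0//; apply: chain_op_norm.
rewrite (_ : p * _ = p * (\sum_(i < n) ((p - theta) * (E i true (increment G) - M)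
    - (1 - p) * (E i true G - E i false G - init_weight alpha beta N i * M)))
    + M * first_order theta); last first.
  rewrite /first_order [M * _]mulrCA -mulrDr [M * _]mulr_sumr -big_split; congr (_ * _).
  by apply: eq_bigr => i _ /=; ring.
apply: le_trans (ler_normD _ _) _; rewrite mulrDr; apply: lerD; last first.
  by rewrite normrM ler_wpM2r.
rewrite normrM (gtr0_norm p0) mulrCA [n%:R * p]mulrC -[leRHS]mulrA.
apply: ler_wpM2l; first exact: ltW.
apply: le_trans (ler_norm_sum _ _ _) _.
apply: (@le_trans _ _ (\sum_(i < n) (L * (`|p - theta| * near_bound alpha beta N
                   + (1 - p) * diff_bound alpha beta N)))); last first.
  by rewrite sumr_const card_ord -mulr_natl le_eqVlt; apply/orP; left; apply/eqP; ring.
apply: ler_sum => i _; apply: le_trans (ler_normB _ _) _.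
rewrite [leRHS]mulrDr; apply: lerD.
  by rewrite normrM mulrCA; apply: ler_wpM2l => //; apply: split_exp_near; rewrite // -ltnS.
rewrite normrM (gtr0_norm q0) mulrCA; apply: ler_wpM2l; first exact: ltW.
by apply: split_exp_diff_near; rewrite // -ltnS.
Qed.

Local Notation sm := (2 * K1 alpha beta / Num.sqrt n%:R).

Let t01 : 0 < t < 1.
Proof.
move: a01 b01 => /andP[a0 a1] /andP[b0 b1].
by rewrite lt_max gt_max a0 a1 b1.
Qed.

Let sE : s = 5 / 2 * sm.
Proof. by rewrite /smoothness; field; rewrite gt_eqF// sqrtr_gt0 ltr0n. Qed.

Let d_le : d <= t.
Proof.
move: a01 b01 => /andP[a0 a1] /andP[b0 b1].
rewrite ler_norml; apply/andP; split.
  by rewrite -lerN2 opprK opprB (@le_trans _ _ alpha)// ?le_max ?lexx// gerBl ltW.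
by rewrite (@le_trans _ _ beta)// ?le_max ?lexx ?orbT// gerBl ltW.
Qed.

Let p_le : p <= t / (1 - t).
Proof.
move: a01 b01 => /andP[a0 a1] /andP[b0 b1]; move: t01 => /andP[t0 t1].
have h1 : alpha <= t by rewrite le_max lexx.
have h2 : beta <= t by rewrite le_max lexx orbT.
rewrite /p1; apply: ler_pM => //; first exact: ltW.
  by rewrite invr_ge0; lra.
rewrite lef_pV2 ?posrE; lra.
Qed.

Let sm0 : 0 < sm.
Proof. by have := smoothness_gt0 a01 b01 (ltn0Sn N); rewrite sE; lra. Qed.

Let dd : d / (1 - d) <= t / (1 - t).
Proof.
move: t01 => /andP[t0 t1]; have := d_le => h.
by apply: ler_pM; rewrite // ?invr_ge0 ?lef_pV2 ?posrE; lra.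
Qed.

Let dt_pow : d ^+ J.+1 / (1 - d) <= t / (1 - t) * t ^+ J.
Proof.
move: t01 => /andP[t0 t1].
rewrite exprS mulrAC; apply: ler_pM => //; rewrite ?divr_ge0 ?exprn_ge0//.
  by rewrite subr_ge0 ltW// delta_lt1.
by apply: lerXn2r; rewrite ?nnegrE// ltW.
Qed.

Lemma near_bound_le : near_bound alpha beta N <= C1 alpha beta * (sm + t ^+ J).
Proof.
move: t01 => /andP[t0 t1]; have tt0 : 0 <= t / (1 - t) by rewrite divr_ge0//; lra.
have tJ : 0 <= t ^+ J by rewrite exprn_ge0// ltW.
rewrite /near_bound /C1 -[10 * t / _]mulrA sE /=.
have s0 := sm0.
have q1 := ler_wpM2r (ltW s0) p_le.
have q2 := ler_wpM2r (ltW s0) dd.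
have q3 := dt_pow.
have q4 : 0 <= t / (1 - t) * sm by rewrite mulr_ge0// ltW.
have q5 : 0 <= t / (1 - t) * t ^+ J by rewrite mulr_ge0.
move: q1 q2 q3 q4 q5; move: (t / (1 - t)) (d / _) (d ^+ _ / _) (t ^+ J) (sm) => u x y z m.
rewrite /stationary_law; move: (p1 alpha beta) => pp; lra.
Qed.

Lemma diff_bound_le : diff_bound alpha beta N <=
  d * (5 + 23 * t) / (1 - t) ^+ 2 * (sm + t ^+ J).
Proof.
move: t01 => /andP[t0 t1]; have s0 := sm0; have dle := d_le.
have tJ : 0 <= t ^+ J by rewrite exprn_ge0// ltW.
have d0 : 0 <= d by [].
have d1 : 0 < 1 - d by lra.
have it0 : 0 < (1 - t)^-1 by rewrite invr_gt0; lra.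
have it1 : 1 <= (1 - t)^-1 by rewrite invf_ge1; lra.
have iE : t * (1 - t)^-1 = (1 - t)^-1 - 1 by field; rewrite gt_eqF//; lra.
have idt : (1 - d)^-1 <= (1 - t)^-1 by rewrite lef_pV2 ?posrE; lra.
have dJ : d ^+ J.+1 / (1 - d) <= d * (1 - t)^-1 * t ^+ J.
  rewrite exprS mulrAC; apply: ler_pM => //; rewrite ?divr_ge0 ?exprn_ge0 ?(ltW d1)//.
    by apply: ler_wpM2l.
  by apply: lerXn2r; rewrite ?nnegrE// ltW.
have dd1 : d / (1 - d) <= d * (1 - t)^-1 by apply: ler_wpM2l.
have dd2 : d / (1 - d) ^+ 2 <= d * (1 - t)^-1 ^+ 2.
  rewrite -exprVn; apply: ler_wpM2l => //.
  by apply: lerXn2r => //; rewrite nnegrE invr_ge0; lra.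
have nb0 : near_bound alpha beta N <= t * (1 - t)^-1 * (3 * s + 4 * t ^+ J).
  rewrite /near_bound /=.
  have s0' : 0 <= s by rewrite ltW// smoothness_gt0.
  have q1 := ler_wpM2r s0' p_le.
  have q2 := ler_wpM2r s0' dd.
  have q3 := dt_pow.
  move: q1 q2 q3; rewrite /stationary_law.
  move: (t / (1 - t)) (d / _) (d ^+ _ / _) (t ^+ J) (s) (p1 alpha beta) => u x y z m pp; lra.
rewrite /diff_bound -[((1 - t) ^+ 2)^-1]exprVn.
set i := (1 - t)^-1 in it0 it1 iE idt dJ dd1 dd2 nb0 *.
set z := t ^+ J in tJ dJ nb0 *.
have s0' : 0 <= s by rewrite ltW// smoothness_gt0.
have i0 := ltW it0.
have di0 : 0 <= d * i by rewrite mulr_ge0.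
(* all terms become multiples of [d * i ^+ 2] *)
have r1 : 2 * s * (d / (1 - d) ^+ 2) <= d * i ^+ 2 * (2 * s).
  by rewrite mulrC; apply: ler_wpM2r => //; rewrite mulr_ge0.
have r2 : 2 * near_bound alpha beta N * (d / (1 - d)) <=
    d * i ^+ 2 * (2 * t * (3 * s + 4 * z)).
  apply: (@le_trans _ _ (2 * (t * i * (3 * s + 4 * z)) * (d * i))).
    have nn := near_bound_ge0 a01 b01 N.
    by apply: ler_pM => //; [exact: mulr_ge0|rewrite divr_ge0// ltW|rewrite ler_wpM2l].
  by rewrite le_eqVlt; apply/orP; left; apply/eqP; ring.
have r3 : (s * (d / (1 - d)) + 2 * (d ^+ J.+1 / (1 - d))) * (d / (1 - d)) <=
    d * i ^+ 2 * (t * (s + 2 * z)).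
  apply: (@le_trans _ _ ((s * (d * i) + 2 * (d * i * z)) * (t * i))).
    apply: ler_pM => //; rewrite ?divr_ge0 ?(ltW d1)//.
    - by rewrite addr_ge0// mulr_ge0// divr_ge0 ?exprn_ge0// ltW.
    - by apply: lerD; rewrite ler_wpM2l.
  by rewrite le_eqVlt; apply/orP; left; apply/eqP; ring.
have r4 : 4 * (d ^+ J.+1 / (1 - d)) <= d * i ^+ 2 * (4 * z).
  apply: (@le_trans _ _ (4 * (d * i * z))); first by rewrite ler_wpM2l.
  have := mulr_ge0 di0 tJ => h; have := ler_wpM2l h it1; lra.
apply: le_trans (lerD (lerD (lerD r1 r2) r3) r4) _.
rewrite -!mulrDr [leRHS](_ : _ = d * i ^+ 2 * ((5 + 23 * t) * (sm + z))); last by ring.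
apply: ler_wpM2l; first by rewrite mulr_ge0// exprn_ge0.
rewrite sE; have w1 : 0 <= t * sm by rewrite mulr_ge0 ?ltW.
have w2 : 0 <= t * z by apply: mulr_ge0 => //; exact: ltW.
move: s0 w1 w2 tJ; move: (sm) => m; lra.
Qed.

End stein_error.

(** * Laws given by weights on the natural numbers *)

Section discrete_law.
Context {R : realType}.
Variable w : nat -> R.
Hypothesis w0 : forall k, 0 <= w k.

Let mass (A : set nat) : \bar R := (\esum_(k in A) (w k)%:E)%E.

Let mass_ge0 A : (0 <= mass A)%E.
Proof. by apply: esum_ge0 => k _; rewrite lee_fin. Qed.

Let massE A : mass A = (\sum_(k <oo) ((k \in A)%:R * w k)%:E)%E.
Proof.
rewrite nneseries_esumT; last by move=> *; rewrite lee_fin mulr_ge0.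
rewrite /mass esum_mkcond; apply: eq_esum => k _.
by case: ifP; rewrite ?mul1r ?mul0r.
Qed.

Lemma esum_partial_le (A : set nat) k :
  ((\sum_(i < k) (nat_of_ord i \in A)%:R * w i)%:E <= mass A)%E.
Proof.
rewrite massE -sumEFin; apply: le_trans (nneseries_lim_ge k _); last first.
  by move=> i _ _; rewrite lee_fin mulr_ge0.
by rewrite big_mkord.
Qed.

Lemma series_cvg_esumT : (fun k => \sum_(i < k.+1) w i) @ \oo --> (1 : R) <->
  mass setT = 1%E.
Proof.
have e : mass setT = limn (EFin \o series w).
  rewrite massE; apply: congr_lim; apply/funext => k /=.
  rewrite /series/= sumEFin; congr EFin; apply: eq_bigr => i _.
  by rewrite in_setT mul1r.
have nd : nondecreasing_seq (series w).
  by apply/nondecreasing_seqP => k; rewrite seriesSr lerDl.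
have c : (fun k => \sum_(i < k.+1) w i) = (fun k => series w k.+1).
  by apply/funext => k; rewrite /series/= big_mkord.
rewrite c cvg_shiftS; split => [h|h].
  by rewrite e EFin_lim ?(cvg_lim _ h)//; apply/cvg_ex; exists 1.
have sle k : series w k <= 1.
  rewrite -lee_fin -h; apply: le_trans (esum_partial_le setT k).
  rewrite lee_fin /series/= big_mkord ler_sum// => i _.
  by rewrite in_setT mul1r.
have cw : cvgn (series w).
  by apply: nondecreasing_is_cvgn => //; exists 1 => _ [k _ <-].
by move: e; rewrite h EFin_lim// => -[->].
Qed.

Hypothesis total : mass setT = 1%E.

Lemma esum_setC A : (mass A + mass (~` A) = 1)%E.
Proof.
rewrite -total /mass (esumID A setT) ?setTI//.
by move=> k _; rewrite lee_fin.
Qed.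

Lemma esum_fin A : mass A \is a fin_num.
Proof.
rewrite ge0_fin_numE//; apply: (@le_lt_trans _ _ 1%E); last exact: ltry.
by rewrite -(esum_setC A) leeDl.
Qed.

Lemma fine_esum_setC A : fine (mass A) + fine (mass (~` A)) = 1.
Proof. by apply/EFin_inj; rewrite EFinD !fineK ?esum_fin ?esum_setC. Qed.

Lemma esum_tail_le (A : set nat) k :
  fine (mass A) - \sum_(i < k) (nat_of_ord i \in A)%:R * w i <= 1 - \sum_(i < k) w i.
Proof.
have h := fine_esum_setC A.
have := esum_partial_le (~` A) k; rewrite -[mass _]fineK ?esum_fin// lee_fin.
have -> : \sum_(i < k) (nat_of_ord i \in ~` A)%:R * w i =
    \sum_(i < k) w i - \sum_(i < k) (nat_of_ord i \in A)%:R * w i.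
  rewrite -sumrB; apply: eq_bigr => i _; rewrite in_setC.
  by case: (_ \in A); rewrite ?mul1r ?mul0r ?subrr ?subr0.
lra.
Qed.

End discrete_law.

(** * The law of the chain sum *)

Section law_of_chain_sum.
Context {R : realType} {disp : measure_display} {T : measurableType disp}.
Variables (P : probability T R) (alpha beta : R).
Hypothesis a01 : 0 < alpha < 1.
Hypothesis b01 : 0 < beta < 1.
Variables (N : nat) (X : 'I_N.+1 -> {RV P >-> bool}).
Local Notation Q := (transition alpha beta).
Hypothesis mcX : markov_chain X Q.
Hypothesis initX : initial_law X (stationary_law alpha beta).

Let past (i : nat) (x : 'I_N.+1 -> bool) : set T :=
  [set u | forall l : 'I_N.+1, (l <= i)%N -> X l u = x l].

Let upd (x : 'I_N.+1 -> bool) (j : 'I_N.+1) (b : bool) (l : 'I_N.+1) :=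
  if l == j then b else x l.

Let count (i : nat) (x : 'I_N.+1 -> bool) : nat :=
  (\sum_(l < N.+1 | (l <= i)%N) x l)%N.

Let measurable_state l b : measurable [set u | X l u = b].
Proof.
have := @measurable_funPTI _ _ _ _ (X l) [set b]; apply.
by [].
Qed.

Let measurable_past i x : measurable (past i x).
Proof.
have -> : past i x = \bigcap_(l in [set l : 'I_N.+1 | (l <= i)%N]) [set u | X l u = x l].
  by apply/seteqP; split.
apply: fin_bigcap_measurable => [|l _]; last exact: measurable_state.
exact: finite_finset.
Qed.

Let measurable_sum (A : set nat) : measurable (chain_sum X @^-1` A).
Proof. by have := @measurable_funPTI _ _ _ _ (chain_sum X) A; apply. Qed.

Let prob (A : set T) : R := fine (P A).

Let probE A : measurable A -> (prob A)%:E = P A.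
Proof. by move=> mA; rewrite /prob fineK// fin_num_measure. Qed.

Let past_split (i : nat) (j : 'I_N.+1) x : j = i.+1 :> nat ->
  forall b, past i x `&` [set u | X j u = b] = past j (upd x j b).
Proof.
move=> ji b; apply/seteqP; split => u.
  move=> [pu jb] l; rewrite /upd; case: eqP => [-> //|/eqP lj].
  rewrite leq_eqVlt => /orP[/eqP/val_inj le|lt]; first by rewrite le eqxx in lj.
  by apply: pu; rewrite -ltnS -ji.
move=> pu; split; last by have := pu j (leqnn _); rewrite /upd eqxx.
move=> l li; have := pu l; rewrite ji leqW// => /(_ isT) ->.
rewrite /upd; case: eqP => // lj; by move: li; rewrite lj ji ltnn.
Qed.

Let prob_split (C D : set T) (j : 'I_N.+1) : measurable C -> measurable D ->
  prob (C `&` D) = prob (C `&` [set u | X j u = false] `&` D)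
                 + prob (C `&` [set u | X j u = true] `&` D).
Proof.
move=> mC mD; have mj b := measurable_state j b.
have m1 b : measurable (C `&` [set u | X j u = b] `&` D).
  by apply: measurableI => //; exact: measurableI.
apply/EFin_inj; rewrite EFinD !probE//; last exact: measurableI.
rewrite -measureU//.
- congr (P _); apply/seteqP; split => u.
    by move=> [Cu Du]; case E: (X j u); [right|left]; split.
  by move=> [[[Cu _] Du]|[[Cu _] Du]]; split.
- by apply/seteqP; split => // u [[[_ /= ->] _] [[_ /=]]].
Qed.

Let past_step (i : nat) (j : 'I_N.+1) x b : j = i.+1 :> nat ->
  forall k : 'I_N.+1, k = i :> nat ->
  prob (past j (upd x j b)) = prob (past i x) * Q (x k) b.
Proof.
move=> ji k ki.
have pe : past i (upd x j b) = past i x.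
  by apply/seteqP; split => u pu l li; have := pu l li; rewrite /upd;
    case: eqP => // lj; move: li; rewrite lj ji ltnn.
have kb : upd x j b k = x k.
  rewrite /upd; case: eqP => // kj; have := ji; rewrite -kj ki => /eqP.
  by rewrite -[X in X == _]addn0 -addn1 eqn_add2l.
have jb : upd x j b j = b by rewrite /upd eqxx.
have jk : j = k.+1 :> nat by rewrite ki.
have := @mcX k j (upd x j b) jk.
rewrite kb jb (_ : [set _ | _] = past i x); last by rewrite -pe -ki.
rewrite -(past_split x ji).
have [P0 _|P0 /(_ P0)] := eqVneq (P (past i x)) 0%E.
  have mI : measurable (past i x `&` [set u | X j u = b]) by exact: measurableI.
  have le0 : (P (past i x `&` [set u | X j u = b]) <= 0)%E.
    by rewrite -P0; apply: le_measure; rewrite ?inE//; exact: subIsetl.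
  rewrite /prob P0 mul0r; apply/EFin_inj; rewrite fineK ?fin_num_measure//.
  by apply/eqP; rewrite eq_le measure_ge0 andbT.
rewrite /cond_prob setIC => <-; rewrite mulrC divfK//.
by apply: contraNneq P0 => h; rewrite -probE// /prob h.
Qed.

Let count_step (i : nat) (j : 'I_N.+1) x b : j = i.+1 :> nat ->
  count j (upd x j b) = (count i x + b)%N.
Proof.
move=> ji; rewrite /count (bigD1 j)//= {1}/upd eqxx addnC; congr (_ + _)%N.
apply: eq_big => [l|l].
  rewrite ji -val_eqE /= ji; lia.
by move=> /andP[_ lj]; rewrite /upd (negbTE lj).
Qed.

Let past_last x u : past N x u -> chain_sum X u = count N x.
Proof.
move=> pu; rewrite /chain_sum /count.
apply: eq_big => [l|l _]; first by rewrite -ltnS ltn_ord.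
by rewrite pu// -ltnS ltn_ord.
Qed.

(** The Markov property is used from the last time backwards: on the event that
  the path up to time [i] is [x], the remaining [k] steps are an application of
  [chain_op]. *)
Let past_law (A : set nat) (k : nat) (i : 'I_N.+1) x : (i + k)%N = N ->
  prob (past i x `&` chain_sum X @^-1` A) =
  prob (past i x) *
  chain_op alpha beta k (fun=> fun c => (c \in A)%:R) (x i) (count i x).
Proof.
elim: k i x => [|k IH] i x ik.
  have iN : i = N :> nat by move: ik; rewrite addn0.
  rewrite /= iN; case: (boolP (count N x \in A)) => [cA|cA]; rewrite ?mulr1 ?mulr0.
    congr prob; apply: setIidl => u /past_last /= ->; exact: set_mem.
  have -> : past N x `&` chain_sum X @^-1` A = set0.
    apply/seteqP; split => // u [/past_last e /=]; rewrite e => Au.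
    by move: cA; rewrite mem_set.
  by rewrite /prob measure0.
have jN : (i.+1 < N.+1)%N by move: ik; clear; lia.
pose j := Ordinal jN.
have jk : (j + k)%N = N by move: ik; rewrite /= addSnnS.
have ji : j = i.+1 :> nat by [].
rewrite (prob_split j (measurable_past i x) (measurable_sum A)).
rewrite !(past_split x ji) !IH// !(past_step x _ ji (k := i))// !(count_step x _ ji).
by rewrite /upd !eqxx addn0 addn1 /=; ring.
Qed.

Lemma chain_sum_law (A : set nat) :
  distribution P (chain_sum X) A =
  (stat_exp alpha beta N (fun k => (k \in A)%:R))%:E.
Proof.
rewrite /distribution /pushforward -probE//; congr EFin.
rewrite -[chain_sum X @^-1` A]setTI (prob_split ord0 measurableT (measurable_sum A)).
have start b : setT `&` [set u | X ord0 u = b] = past 0 (fun=> b).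
  rewrite setTI; apply/seteqP; split => u /=.
    by move=> ub l; rewrite leqn0 => /eqP l0; rewrite (_ : l = ord0)//; exact/val_inj.
  by apply.
have cnt b : count 0 (fun=> b) = b.
  rewrite /count (bigD1 ord0)//= big1 ?addn0// => l /andP[].
  by rewrite leqn0 -val_eqE => ->.
rewrite !start !(past_law A (k := N) (i := ord0))//.
have p0 b : prob (past 0 (fun=> b)) = stationary_law alpha beta b.
  by apply/EFin_inj; rewrite probE// -start setTI initX.
by rewrite !p0 !cnt.
Qed.

Let eq_op_range k f g x c : (forall i, (i <= c + k)%N -> f i = g i) ->
  chain_op alpha beta k (fun=> f) x c = chain_op alpha beta k (fun=> g) x c.
Proof.
elim: k x c => [|k IH] x c fg /=; first by rewrite fg// addn0.
by rewrite !IH// => i hi; apply: fg; lia.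
Qed.

Let stat_exp_range f g : (forall i, (i <= N.+1)%N -> f i = g i) ->
  stat_exp alpha beta N f = stat_exp alpha beta N g.
Proof.
by move=> fg; rewrite /stat_exp !(eq_op_range (g := g))// => i hi; apply: fg; lia.
Qed.

Let chain_sum_le u : (chain_sum X u <= N.+1)%N.
Proof.
rewrite /chain_sum -[leqRHS]card_ord -sum1_card.
by apply: leq_sum => i _; case: (X i u).
Qed.

Lemma chain_sum_expectation (f : nat -> R) : (forall k, 0 <= f k) ->
  'E_P[fun u => f (chain_sum X u)]%E = (stat_exp alpha beta N f)%:E.
Proof.
move=> f0; rewrite unlock.
have fE u : (f (chain_sum X u))%:E =
    (\sum_(k < N.+2) (f k)%:E * (\1_(chain_sum X @^-1` [set (k : nat)]) u)%:E)%E.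
  rewrite (bigD1 (Ordinal (chain_sum_le u : (chain_sum X u < N.+2)%N)))//= big1.
    by rewrite adde0 indicE mem_set// mule1.
  move=> k kS; rewrite indicE memNset ?mule0//= => h.
  by move: kS; rewrite -val_eqE /= h eqxx.
under eq_integral do rewrite fE.
have mI (k : nat) : measurable (chain_sum X @^-1` [set k]) by exact: measurable_sum.
rewrite ge0_integral_sum//; last 2 first.
- move=> k; apply: measurable_funeM; apply/measurable_EFinP.
  exact: measurable_indic.
- by move=> k u _; rewrite -EFinM lee_fin mulr_ge0.
have term (k : 'I_N.+2) : (\int[P]_u ((f k)%:E * (\1_(chain_sum X @^-1` [set (k : nat)]) u)%:E)
   = (f k * stat_exp alpha beta N (fun i => (i \in [set (k : nat)])%:R))%:E)%E.
  rewrite ge0_integralZl//.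
  - by rewrite integral_indic// setIT EFinM -chain_sum_law.
  - by apply/measurable_EFinP; exact: measurable_indic.
  - by rewrite lee_fin.
rewrite (eq_bigr _ (fun k _ => term k)) sumEFin; congr EFin.
have lin m (h : 'I_m -> R) (G : 'I_m -> nat -> R) :
    \sum_(k < m) h k * stat_exp alpha beta N (G k) =
    stat_exp alpha beta N (fun i => \sum_(k < m) h k * G k i).
  elim: m h G => [|m IH] h G.
    rewrite big_ord0; rewrite -[LHS](stat_exp_cst a01 b01 N); apply: eq_stat_exp => i.
    by rewrite big_ord0.
  rewrite big_ord_recl IH -[X in _ + X]mul1r -stat_exp_lin.
  by apply: eq_stat_exp => i; rewrite big_ord_recl mul1r.
rewrite lin; apply: stat_exp_range => i iN.
rewrite (bigD1 (Ordinal (iN : (i < N.+2)%N)))//= big1.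
  by rewrite addr0 mem_set ?mulr1.
move=> k ki; rewrite memNset ?mulr0//= => h.
by move: ki; rewrite -val_eqE /= h eqxx.
Qed.

Lemma chain_sum_mean :
  fine 'E_P[fun u => (chain_sum X u)%:R]%E = N.+1%:R * p1 alpha beta.
Proof. by rewrite (chain_sum_expectation (f := fun k => k%:R))//= stat_exp_mean. Qed.

Lemma chain_sum_variance :
  fine 'V_P[fun u => (chain_sum X u)%:R]%E =
  stat_exp alpha beta N (fun k => k%:R ^+ 2) - (N.+1%:R * p1 alpha beta) ^+ 2.
Proof.
rewrite /variance unlock chain_sum_mean.
have := chain_sum_expectation (f := fun k => (k%:R - N.+1%:R * p1 alpha beta) ^+ 2).
move=> /(_ (fun k => sqr_ge0 _)) h.
set Y := (X in 'E_P[X]%E).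
have -> : Y = (fun u => ((chain_sum X u)%:R - N.+1%:R * p1 alpha beta) ^+ 2).
  by apply/funext => u; rewrite /Y expr2.
rewrite h /=.
pose m : R := N.+1%:R * p1 alpha beta.
rewrite (eq_stat_exp _ _ _ (g := fun k => 1 * k%:R ^+ 2 +
    1 * ((- 2 * m) * k%:R + m ^+ 2 * 1))); last by move=> k; rewrite -/m; ring.
rewrite stat_exp_lin (stat_exp_lin _ _ _ _ _ (fun k => k%:R) (fun=> 1)).
by rewrite stat_exp_mean// (stat_exp_cst a01 b01) -/m; ring.
Qed.

End law_of_chain_sum.

(** * Total variation bounds *)

Section total_variation.
Context {R : realType}.
Variables alpha beta : R.
Hypothesis a01 : 0 < alpha < 1.
Hypothesis b01 : 0 < beta < 1.
Variable N : nat.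
Local Notation n := N.+1.
Local Notation J := (n %/ 4)%N.
Local Notation p := (p1 alpha beta).
Local Notation ES := (stat_exp alpha beta N).
Local Notation mu := (n%:R * p).
Local Notation VS := (ES (fun k => k%:R ^+ 2) - mu ^+ 2).
Local Notation delta := (beta - alpha).
Local Notation t := (Num.max alpha beta).
Local Notation sm := (2 * K1 alpha beta / Num.sqrt n%:R).

Let mu0 : 0 < mu.
Proof. by rewrite mulr_gt0 ?ltr0n// p1_gt0. Qed.

(** The Stein inequality bounds [Q A - P A]; applied to the complement of [A] it
  also bounds [P A - Q A]. *)
Lemma dTV_stein (P : set nat -> \bar R) (w : nat -> R) (theta L : R) :
  (forall A, P A = (ES (fun k => (k \in A)%:R))%:E) ->
  (forall k, 0 <= w k) -> (\esum_(k in setT) (w k)%:E)%E = 1%E ->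
  (forall A, stein_bounded mu theta L (fun k => k \in A)
     (fine (\esum_(k in A) (w k)%:E)%E)) ->
  (dTV P (fun A => \esum_(k in A) (w k)%:E)%E <=
   (L * (mu * (`|p - theta| * near_bound alpha beta N
               + (1 - p) * diff_bound alpha beta N)
         + `|first_order alpha beta N theta|))%:E)%E.
Proof.
move=> PE w0 total stein; set b := (X in X%:E).
have one A : fine (\esum_(k in A) (w k)%:E)%E - ES (fun k => (k \in A)%:R) <= b.
  have [g hg gL] := stein A.
  have := stat_exp_le a01 b01 N hg.
  rewrite -/(stein_exp alpha beta N mu theta g).
  set q := fine _.
  have -> : ES (fun k => (k \in A)%:R - q) = ES (fun k => (k \in A)%:R) - q.
    rewrite (eq_stat_exp _ _ _ (g := fun k => 1 * (k \in A)%:R + (- q) * 1)).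
      by rewrite (stat_exp_lin _ _ _ _ _ _ (fun=> 1)) (stat_exp_cst a01 b01); ring.
    by move=> k; ring.
  have := stein_exp_bound a01 b01 N theta gL; rewrite -/b ler_norml => /andP[h' _].
  lra.
apply: ge_ereal_sup => _ [A _ <-].
have qf := esum_fin w0 total A.
rewrite PE -[X in (_ - X)%E](fineK qf) -EFinB abse_EFin lee_fin ler_norml.
have := one A; have := one (~` A).
have -> : fine (\esum_(k in ~` A) (w k)%:E)%E = 1 - fine (\esum_(k in A) (w k)%:E)%E.
  by rewrite -(fine_esum_setC w0 total A) addrC addKr.
have -> : ES (fun k => (k \in ~` A)%:R) = 1 - ES (fun k => (k \in A)%:R).
  rewrite (eq_stat_exp _ _ _ (g := fun k => 1 * 1 + (- 1) * (k \in A)%:R)).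
    by rewrite (stat_exp_lin _ _ _ _ _ (fun=> 1)) (stat_exp_cst a01 b01); ring.
  by move=> k; rewrite in_setC; case: (_ \in A) => /=; ring.
by move=> h1 h2; apply/andP; split; lra.
Qed.

Let VE theta : first_order alpha beta N theta = mu * (1 - theta) - VS.
Proof. exact: first_orderE. Qed.

Let t01 : 0 < t < 1.
Proof.
move: a01 b01 => /andP[a0 a1] /andP[b0 b1].
by rewrite lt_max gt_max a0 a1 b1.
Qed.

Let sm_ge0 : 0 <= sm.
Proof.
by rewrite divr_ge0 ?sqrtr_ge0// mulr_ge0// mulr_ge0 ?sqrtr_ge0.
Qed.

Lemma K2_ge0 : 0 <= K2 alpha beta.
Proof.
move: (a01) (b01) => /andP[a0 a1] /andP[b0 b1].
have h1 : 0 <= mu1 alpha by rewrite divr_ge0 ?subr_ge0// ltW.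
have h2 : 0 <= mu2 beta by rewrite divr_ge0 ?subr_ge0// ltW.
have h3 : 0 <= sigma1sq alpha by rewrite divr_ge0 ?subr_ge0 ?sqr_ge0// ltW.
have h4 : 0 <= sigma2sq beta by rewrite divr_ge0 ?sqr_ge0// ltW.
by rewrite /K2 divr_ge0// ?mulr_ge0// !addr_ge0.
Qed.

Lemma geo_sum_le0 (d : R) m : -1 < d -> d <= 0 -> \sum_(j < m) d ^+ j.+1 <= 0.
Proof.
move=> d1 d0; have e : 0 < 1 - d by lra.
rewrite -(pmulr_lle0 _ e).
suff -> : (\sum_(j < m) d ^+ j.+1) * (1 - d) = d * (1 - d ^+ m).
  rewrite mulr_le0_ge0// subr_ge0 (le_trans (ler_norm _))// normrX exprn_ile1//.
  by rewrite ler_norml; apply/andP; split; lra.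
elim: m => [|m IH]; first by rewrite big_ord0 mul0r expr0 subrr mulr0.
by rewrite big_ord_recr/= mulrDl IH exprS; ring.
Qed.

(** When the variance is at least the mean, [theta = 1 - VS / mu] is nonpositive
  and kills the first order term; this forces positive correlations and ties
  [p - theta] to [beta - alpha]. *)
Lemma overdispersed_bound theta : mu <= VS -> theta = 1 - VS / mu ->
  mu^-1 * (mu * (`|p - theta| * near_bound alpha beta N
                 + (1 - p) * diff_bound alpha beta N)
           + `|first_order alpha beta N theta|) <=
  C0 alpha beta * (sm + 4 * K2 alpha beta / n%:R + beta ^+ J).
Proof.
move=> muV thE.
have p0 := p1_gt0 a01 b01; have p1' := p1_lt1 a01 b01.
have n0 : 0 < n%:R :> R by rewrite ltr0n.
have fo : first_order alpha beta N theta = 0.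
  by rewrite VE thE; field; rewrite (gt_eqF p0) gt_eqF//= -natr1 ltr_wpDl.
rewrite fo normr0 addr0 mulKf ?gt_eqF//.
have th0 : theta <= 0 by rewrite thE subr_le0 ler_pdivlMr// mul1r.
have sumE : n%:R * (p - theta) = (1 - p) * \sum_(i < n) init_weight alpha beta N i.
  move/eqP: fo; rewrite /first_order mulf_eq0 (gt_eqF p0)/= sumrB.
  by rewrite sumr_const card_ord -mulr_sumr subr_eq0 mulr_natl => /eqP.
have dlt := delta_lt1 a01 b01.
have dpos : 0 < delta.
  rewrite ltNge; apply/negP => d0; move: dlt; rewrite ltr_norml => /andP[dm _].
  have : \sum_(i < n) init_weight alpha beta N i <= 0.
    by apply: sumr_le0 => i _; rewrite -[leRHS]addr0 lerD ?geo_sum_le0.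
  have : 0 < n%:R * (p - theta) by rewrite mulr_gt0//; lra.
  by rewrite sumE pmulr_rgt0 ?subr_gt0// => /lt_geF ->.
have tE : t = beta by apply/max_idPr; lra.
have iw i : init_weight alpha beta N i <= 2 * (`|delta| / (1 - `|delta|)).
  have d01 : 0 <= delta < 1 by move: dlt; rewrite gtr0_norm// => ->; rewrite ltW.
  rewrite gtr0_norm// /init_weight mulr_natl mulr2n.
  by apply: lerD; apply: geo_sum.
have pth : `|p - theta| <= (1 - p) * (2 * (`|delta| / (1 - `|delta|))).
  rewrite ger0_norm; last lra.
  rewrite -(ler_pM2l n0) sumE mulrCA ler_pM2l ?subr_gt0//.
  apply: (@le_trans _ _ (\sum_(i < n) 2 * (`|delta| / (1 - `|delta|)))).
    by apply: ler_sum => i _; exact: iw.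
  by rewrite sumr_const card_ord [leRHS]mulr_natl.
have nb := near_bound_le a01 b01 N; have db := diff_bound_le a01 b01 N.
have nb0 := near_bound_ge0 a01 b01 N.
move: (t01) => /andP[t0 t1].
set z := sm + t ^+ J in nb db.
have z0 : 0 <= z by rewrite addr_ge0// exprn_ge0// ltW.
have dle : `|delta| <= t.
  by move: (a01) => /andP[a0 _]; rewrite gtr0_norm// tE; lra.
have idt : (1 - `|delta|)^-1 <= (1 - t)^-1 by rewrite lef_pV2 ?posrE; lra.
apply: (@le_trans _ _ (C0 alpha beta * z)); last first.
  have C00 : 0 <= C0 alpha beta.
    by rewrite /C0 divr_ge0 ?sqr_ge0// mulr_ge0//; lra.
  rewrite ler_wpM2l// /z tE -addrA lerD2l lerDr.
  by rewrite divr_ge0// mulr_ge0// K2_ge0.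
have C10 : 0 <= C1 alpha beta by rewrite /C1 divr_ge0; lra.
have i0 : 0 <= (1 - t)^-1 by rewrite invr_ge0; lra.
apply: (@le_trans _ _ (2 * (`|delta| * (1 - t)^-1) * (C1 alpha beta * z) +
   `|delta| * (5 + 23 * t) / (1 - t) ^+ 2 * z)).
  apply: lerD.
    apply: ler_pM => //; apply: (le_trans pth).
    apply: (@le_trans _ _ (2 * (`|delta| / (1 - `|delta|)))).
      by rewrite ler_piMl ?mulr_ge0 ?invr_ge0//; lra.
    by rewrite !ler_wpM2l.
  apply: (le_trans _ db); rewrite ler_piMl//; last by lra.
  exact: diff_bound_ge0.
rewrite /C0 /C1 le_eqVlt; apply/orP; left; apply/eqP.
by field; rewrite gt_eqF//; lra.
Qed.

(** As S is integer valued, its second moment is at least its mean. *)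
Lemma trials_gt0 : VS < mu -> (0 < Num.truncn (mu ^+ 2 / (mu - VS)))%N.
Proof.
move=> Vmu; rewrite truncn_gt0 ler_pdivlMr ?subr_gt0// mul1r.
have : ES (fun k => k%:R) <= ES (fun k => k%:R ^+ 2).
  apply: (stat_exp_le a01 b01) => k; rewrite -natrX ler_nat.
  by case: k => // k; rewrite leq_pmulr.
by rewrite stat_exp_mean// opprB addrCA gerDl subr_le0.
Qed.

(** When the variance is less than the mean, the first order term is the effect of
  rounding the number of trials. *)
Lemma underdispersed_bound : VS < mu ->
  let mt := mu ^+ 2 / (mu - VS) in
  let m := Num.truncn mt in
  let theta := mu / m%:R in
  theta < 1 ->
  (mu * (1 - theta))^-1 * (mu * (`|p - theta| * near_bound alpha beta N
                 + (1 - p) * diff_bound alpha beta N)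
           + `|first_order alpha beta N theta|) <=
  (`|p - theta| / (1 - theta) * C1 alpha beta
     + `|beta - alpha| / (1 - theta) * C2 alpha beta)
    * (sm + 4 * K2 alpha beta / n%:R + (Num.max beta alpha) ^+ J)
  + theta ^+ 2 * (mt - m%:R) / (mu * (1 - theta)).
Proof.
move=> Vmu mt m theta th1.
have m0 : 0 < m%:R :> R by rewrite ltr0n; exact: trials_gt0.
have d0 : 0 < mu - VS by rewrite subr_gt0.
have mtm : m%:R <= mt.
  by rewrite /m truncn_le; rewrite divr_ge0 ?sqr_ge0// ltW.
have mt0 : 0 < mt by apply: lt_le_trans mtm.
have tn : 0 < 1 - theta by rewrite subr_gt0.
have foE : first_order alpha beta N theta = - (mu ^+ 2 / (m%:R * mt) * (mt - m%:R)).
  have VSE : VS = mu - mu ^+ 2 / mt.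
    have gen (x y : R) : x != 0 -> x / (x / y) = y.
      by move=> x0; rewrite invf_div mulrCA divff// mulr1.
    by rewrite /mt gen ?subKr// expf_neq0// gt_eqF.
  rewrite VE [in LHS]VSE /theta; move: (mt) mt0 => u u0.
  by field; rewrite (gt_eqF m0) gt_eqF.
have fo : `|first_order alpha beta N theta| <= theta ^+ 2 * (mt - m%:R).
  rewrite foE normrN ger0_norm; last first.
    by rewrite mulr_ge0 ?subr_ge0// divr_ge0 ?sqr_ge0// mulr_ge0// ltW.
  rewrite ler_wpM2r ?subr_ge0// /theta expr_div_n ler_wpM2l ?sqr_ge0//.
  have a1 : 0 < m%:R * mt by exact: mulr_gt0.
  have a2 : 0 < m%:R ^+ 2 :> R by exact: exprn_gt0.
  by rewrite lef_pV2 ?posrE// expr2 ler_wpM2l// ltW.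
have nb := near_bound_le a01 b01 N; have db := diff_bound_le a01 b01 N.
move: (t01) => /andP[t0 t1]; rewrite [Num.max beta alpha]maxC.
set z := sm + t ^+ J in nb db.
have K20 : 0 <= 4 * K2 alpha beta / n%:R by rewrite divr_ge0// mulr_ge0// K2_ge0.
have zz : z <= sm + 4 * K2 alpha beta / n%:R + t ^+ J by rewrite /z -addrA lerD2l lerDr.
have p1' := p1_lt1 a01 b01.
have C10 : 0 <= C1 alpha beta by rewrite /C1 divr_ge0; lra.
have C20 : 0 <= C2 alpha beta.
  by rewrite /C2 divr_ge0 ?sqr_ge0// mulr_ge0; lra.
rewrite mulrDr; apply: lerD; last first.
  by rewrite mulrC; apply: ler_wpM2r => //; rewrite invr_ge0 mulr_ge0 ?ltW.
rewrite [leLHS](_ : _ = (`|p - theta| * near_bound alpha beta N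
    + (1 - p) * diff_bound alpha beta N) / (1 - theta)); last first.
  by rewrite invfM mulrACA mulVf ?gt_eqF// mul1r mulrC.
rewrite [leRHS](_ : _ = (`|p - theta| * C1 alpha beta + `|beta - alpha| * C2 alpha beta)
    * (sm + 4 * K2 alpha beta / n%:R + t ^+ J) / (1 - theta)); last first.
  by rewrite [`|p - theta| / _ * _]mulrAC [`|beta - alpha| / _ * _]mulrAC -mulrDl mulrAC.
apply: ler_wpM2r; first by rewrite invr_ge0 ltW.
apply: (@le_trans _ _ ((`|p - theta| * C1 alpha beta + `|beta - alpha| * C2 alpha beta) * z)).
  rewrite [leRHS]mulrDl; apply: lerD; first by rewrite -mulrA ler_wpM2l.
  have q0 : 0 <= 1 - p by lra.
  have := ler_wpM2l q0 db => h; apply: (le_trans h).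
  by rewrite /C2 le_eqVlt; apply/orP; left; apply/eqP; field; rewrite gt_eqF//; lra.
by apply: ler_wpM2l => //; rewrite addr_ge0// mulr_ge0.
Qed.

End total_variation.

Lemma nbinom_balance {R : realType} (m v : R) k : 0 < m -> m < v ->
  let r := m ^+ 2 / (v - m) in let q := m / v in
  birth m (1 - v / m) k * nbinom_pmf r q k =
  death (1 - v / m) k.+1 * nbinom_pmf r q k.+1.
Proof.
move=> m0 mv r q; have v0 : 0 < v by apply: lt_trans mv.
have d0 : 0 < v - m by rewrite subr_gt0.
have r0 : 0 < r by rewrite divr_gt0 ?exprn_gt0.
have h := nbinom_coeffS k r0.
transitivity ((v - m) / m * ((r + k%:R) * nbinom_coeff r k) * (q `^ r * (1 - q) ^+ k)).
  have -> : birth m (1 - v / m) k = (v - m) / m * (r + k%:R).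
    by rewrite /birth /r; field; rewrite !gt_eqF.
  by rewrite nbinom_pmfE; ring.
rewrite -h; have -> : (v - m) / m = v / m * (1 - q).
  by rewrite /q; field; rewrite !gt_eqF.
by rewrite nbinom_pmfE /death [(1 - q) ^+ k.+1]exprS; ring.
Qed.

Lemma binomial_balance {R : realType} (m : nat) (theta : R) k :
  birth (m%:R * theta) theta k * binomial_pmf m theta k =
  death theta k.+1 * binomial_pmf m theta k.+1.
Proof.
rewrite /birth /death /binomial_pmf /unstable.onem.
rewrite -[_ *+ 'C(m, k)]mulr_natr -[_ *+ 'C(m, k.+1)]mulr_natr.
have [km|mk] := ltnP k m; last first.
  rewrite (bin_small (mk : (m < k.+1)%N)) mulr0 mulr0.
  move: mk; rewrite leq_eqVlt => /orP[/eqP <-|mk]; first by ring.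
  by rewrite bin_small// !mulr0.
have hb : k.+1%:R * 'C(m, k.+1)%:R = (m%:R - k%:R) * 'C(m, k)%:R :> R.
  by rewrite -natrM mul_bin_left natrM natrB// ltnW.
rewrite (_ : (1 - theta) * k.+1%:R * (theta ^+ k.+1 * (1 - theta) ^+ (m - k.+1) *
   'C(m, k.+1)%:R) = theta ^+ k.+1 * ((1 - theta) * (1 - theta) ^+ (m - k.+1)) *
   (k.+1%:R * 'C(m, k.+1)%:R)); last by ring.
by rewrite hb -exprS subnSK// exprS; ring.
Qed.

Section approximating_laws.
Context {R : realType}.
Variables alpha beta : R.
Hypothesis a01 : 0 < alpha < 1.
Hypothesis b01 : 0 < beta < 1.
Variable N : nat.
Local Notation n := N.+1.
Local Notation p := (p1 alpha beta).
Local Notation ES := (stat_exp alpha beta N).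
Local Notation mu := (n%:R * p).
Local Notation VS := (ES (fun k => k%:R ^+ 2) - mu ^+ 2).

Let mu0 : 0 < mu.
Proof. by rewrite mulr_gt0 ?ltr0n// p1_gt0. Qed.

Lemma poisson_stein : VS = mu ->
  [/\ forall k, 0 <= poisson_pmf mu k,
      (\esum_(k in setT) (poisson_pmf mu k)%:E)%E = 1%E &
      forall A, stein_bounded mu (1 - VS / mu) mu^-1 (fun k => k \in A)
        (fine (\esum_(k in A) (poisson_pmf mu k)%:E)%E)].
Proof.
move=> VE; have w0 k : 0 <= poisson_pmf mu k := poisson_pmf_ge0 mu k.
have total : (\esum_(k in setT) (poisson_pmf mu k)%:E)%E = 1%E.
  have := probability_setT (poisson_prob mu 0 : probability _ R).
  by rewrite /= /poisson_prob mu0.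
have th : 1 - VS / mu = 0 by rewrite VE divff ?subrr// gt_eqF.
split=> // A; rewrite th.
apply: (stein_bounded_full (w := poisson_pmf mu)) => //.
- move=> k; rewrite /birth /death mul0r !subr0 mul1r /poisson_pmf mu0 factS natrM exprS.
  have f0 : k`!%:R != 0 :> R by rewrite pnatr_eq0 -lt0n fact_gt0.
  by field; rewrite f0 nat1r pnatr_eq0.
- exact/series_cvg_esumT.
- by move=> k; rewrite -lee_fin fineK ?esum_fin//; exact: esum_partial_le.
- by move=> k; exact: esum_tail_le.
- by move=> k; rewrite /poisson_pmf mu0 !mulr_gt0 ?exprn_gt0 ?invr_gt0 ?ltr0n ?fact_gt0 ?expR_gt0.
Qed.

Lemma nbinom_stein : mu < VS -> let r := mu ^+ 2 / (VS - mu) in let q := mu / VS in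
  [/\ forall k, 0 <= nbinom_pmf r q k,
      (\esum_(k in setT) (nbinom_pmf r q k)%:E)%E = 1%E &
      forall A, stein_bounded mu (1 - VS / mu) mu^-1 (fun k => k \in A)
        (fine (\esum_(k in A) (nbinom_pmf r q k)%:E)%E)].
Proof.
move=> muV r q; have V0 : 0 < VS by apply: lt_trans muV.
have d0 : 0 < VS - mu by rewrite subr_gt0.
have r0 : 0 < r by rewrite divr_gt0 ?exprn_gt0.
have q01 : 0 < q < 1 by rewrite divr_gt0//= ltr_pdivrMr// mul1r.
have w0 k : 0 <= nbinom_pmf r q k by exact: nbinom_pmf_ge0.
have F1 : (fun k => \sum_(i < k.+1) nbinom_pmf r q i) @ \oo --> (1 : R).
  have := nbinom_series r0 q01; rewrite -cvg_shiftS.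
  by under eq_fun do rewrite /series/= big_mkord.
have total : (\esum_(k in setT) (nbinom_pmf r q k)%:E)%E = 1%E.
  exact/series_cvg_esumT.
split=> // A; apply: (stein_bounded_full (w := nbinom_pmf r q)) => //.
- by rewrite ltrBlDr ltrDl divr_gt0.
- by move=> k; exact: nbinom_balance.
- by move=> k; rewrite -lee_fin fineK ?esum_fin//; exact: esum_partial_le.
- by move=> k; exact: esum_tail_le.
- by rewrite subr_le0 ler_pdivlMr// mul1r ltW.
- move=> k; rewrite nbinom_pmfE; move: q01 => /andP[q0 q1].
  apply: mulr_gt0; last by rewrite exprn_gt0// subr_gt0.
  by apply: mulr_gt0; [exact: nbinom_coeff_gt0|exact: powR_gt0].
Qed.

Lemma binomial_stein (m : nat) : (0 < m)%N -> let theta := mu / m%:R in theta < 1 ->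
  [/\ forall k, 0 <= binomial_pmf m theta k,
      (\esum_(k in setT) (binomial_pmf m theta k)%:E)%E = 1%E &
      forall A, stein_bounded mu theta (mu * (1 - theta))^-1 (fun k => k \in A)
        (fine (\esum_(k in A) (binomial_pmf m theta k)%:E)%E)].
Proof.
move=> m0 theta th1; have mR : 0 < m%:R :> R by rewrite ltr0n.
have th0 : 0 < theta by rewrite divr_gt0.
have th01 : 0 <= theta <= 1 by rewrite !ltW.
have tn : 0 < 1 - theta by rewrite subr_gt0.
have w0 k : 0 <= binomial_pmf m theta k by exact: binomial_pmf_ge0.
have total : (\esum_(k in setT) (binomial_pmf m theta k)%:E)%E = 1%E.
  have := probability_setT (binomial_prob m theta : probability _ R).
  by rewrite /= /binomial_prob th01.
have muE : mu = m%:R * theta by rewrite /theta [RHS]mulrC divfK// gt_eqF.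
split=> // A; apply: (@stein_bounded_binomial R mu theta (binomial_pmf m theta)
  th1 mu0 w0 _ _ _ _ _ _ m th0 m0 muE).
- by move=> k; rewrite muE; exact: binomial_balance.
- exact/series_cvg_esumT.
- by move=> k; rewrite -lee_fin fineK ?esum_fin//; exact: esum_partial_le.
- by move=> k; exact: esum_tail_le.
- move=> k km; rewrite /binomial_pmf -mulr_natr.
  apply: mulr_gt0; last by rewrite ltr0n bin_gt0.
  by apply: mulr_gt0; exact: exprn_gt0.
- by move=> k km; rewrite /binomial_pmf bin_small.
Qed.

End approximating_laws.

Theorem theorem1p1 (R : realType) (d : measure_display) (T : measurableType d)
    (P : probability T R) (n : nat) (alpha beta : R)
    (X : 'I_n -> {RV P >-> bool}) :
  (1 <= n)%N -> 0 < alpha < 1 -> 0 < beta < 1 ->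
  markov_chain X (transition alpha beta) ->
  initial_law X (stationary_law alpha beta) ->
  let p := p1 alpha beta in
  let L := distribution P (chain_sum X) in
  let ES := fine 'E_P[fun w => (chain_sum X w)%:R]%E in
  let VS := fine 'V_P[fun w => (chain_sum X w)%:R] in
  let C0 := C0 alpha beta in
  let C1 := C1 alpha beta in
  let C2 := C2 alpha beta in
  let K1 := K1 alpha beta in
  let K2 := K2 alpha beta in
  let r := ES ^+ 2 / (VS - ES) in
  let q := ES / VS in
  (ES <= VS ->
    (dTV L (if VS == ES then poisson_prob ES 0 else nbinom_prob r q) <=
      (C0 * (2 * K1 / Num.sqrt n%:R + 4 * K2 / n%:R
             + beta ^+ (n %/ 4)))%:E)%E) /\
  (VS < ES ->
    let mt := ES ^+ 2 / (ES - VS) in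
    let m := Num.truncn mt in
    let theta := n%:R * p / m%:R in
    theta < 1 ->
    (dTV L (binomial_prob m theta) <=
      ((`|p - theta| / (1 - theta) * C1 + `|beta - alpha| / (1 - theta) * C2)
       * (2 * K1 / Num.sqrt n%:R + 4 * K2 / n%:R
          + (Num.max beta alpha) ^+ (n %/ 4))
       + theta ^+ 2 * (mt - m%:R) / (n%:R * p * (1 - theta)))%:E)%E).
Proof.
case: n X => [//|N] X _ a01 b01 mcX initX p L ES VS C0' C1' C2' K1' K2' r q.
have n0 : 0 < N.+1%:R :> R by rewrite ltr0n.
have ESE : ES = N.+1%:R * p1 alpha beta by exact: (chain_sum_mean a01 b01 mcX initX).
have VSE := chain_sum_variance a01 b01 mcX initX; rewrite -/VS in VSE.
have law A : L A = (stat_exp alpha beta N (fun k => (k \in A)%:R))%:E.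
  exact: (chain_sum_law a01 b01 mcX initX).
have m0 : 0 < N.+1%:R * p1 alpha beta by rewrite mulr_gt0// p1_gt0.
split.
  rewrite ESE VSE => le_V.
  have bound := overdispersed_bound a01 b01 le_V erefl.
  case: eqP => [eq_V|neq_V].
    have [w0 total st] := poisson_stein a01 b01 eq_V.
    rewrite /poisson_prob m0.
    exact: le_trans (dTV_stein a01 b01 law w0 total st) _.
  have lt_V : N.+1%:R * p1 alpha beta <
      stat_exp alpha beta N (fun k => k%:R ^+ 2) - (N.+1%:R * p1 alpha beta) ^+ 2.
    by rewrite lt_neqAle le_V andbT; apply/eqP => h; apply: neq_V.
  have [w0 total st] := nbinom_stein a01 b01 lt_V.
  rewrite /r /q ESE VSE.
  exact: le_trans (dTV_stein a01 b01 law w0 total st) _.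
rewrite ESE VSE => lt_V mt m theta th1.
have mgt := trials_gt0 a01 b01 lt_V.
have th01 : 0 <= theta <= 1 by rewrite !ltW// divr_gt0// ltr0n.
have [w0 total st] := binomial_stein a01 b01 mgt th1.
rewrite /binomial_prob th01.
apply: le_trans (dTV_stein a01 b01 law w0 total st) _; rewrite lee_fin.
exact: (underdispersed_bound a01 b01 lt_V th1).
Qed.
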